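(* For $n\in\mathbb{N}$ and an integer $t\ge1$, consider $\mathbb{E}[U_t]=\sum_{i=1}^n p_i(1-p_i)^t$ as a function of the probability vector $\mathbf{p}=(p_1,\ldots,p_n)$ on a set $S$ of $n$ elements, with coordinates listed so that $p_1\le p_2\le\cdots\le p_n$. Then: (i) For all $n$ and $t$, every local maximum $\mathbf{p}^*$ of $\mathbb{E}[U_t]$ (over probability vectors) is of the form $$p_1^*=p_2^*=\cdots=p_{n-1}^*\le p_n^*.$$ There exists a function $\tau$ assigning to each $n\in\mathbb{N}$ a threshold $\tau(n)>n$ such that (ii) and (iii) hold: (ii) For every $n$: (a) for $t<\tau(n)$ there is a unique global maximum, and it is $p_1^*=p_2^*=\cdots=p_n^*=\frac1n$; (b) for $t>\tau(n)$ there is a unique global maximum, and it has the form $p_1^*=p_2^*=\cdots=p_{n-1}^*<p_n^*$. (iii) As $n\to\infty$, $\tau(n)=n+\sqrt{2n}\,(1+o(1))$. (iv) For $n\ge 2$ and $t\ge n+\sqrt{2n}$, every global maximum $\mathbf{p}^*$ satisfies $$\frac{1}{t+1}<p_1^*<\frac{1}{t+1}+e^{-\sqrt{n/2}}.$$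
   Context: Let $S$ be a finite set of $n$ elements with a probability measure $P$ having point masses $p_1,\ldots,p_n$, and let $X_1,\ldots,X_t$ be drawn independently from $S$ according to $P$. The missing mass is $U_t=P(S\setminus\{X_1,\ldots,X_t\})$, and $\mathbb{E}[U_t]=\sum_{i=1}^n p_i(1-p_i)^t$. Since this is a symmetric function of the $p_i$, probability vectors are listed in nondecreasing order $p_1\le\cdots\le p_n$; ''unique'' global maximum means unique among nondecreasingly ordered probability vectors, i.e. unique up to permutation of coordinates. In (i) and (ii)(b), the displayed form means that the first $n-1$ coordinates are all equal and each is $\le p_n^*$ (respectively $<p_n^*$); for $n=1$ this is vacuous. Nothing is asserted in (ii) for $t=\tau(n)$. *)

(* Defs.v *)
From mathcomp Require Export all_boot all_order all_algebra.
From mathcomp Require Export all_classical all_reals all_analysis.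

Set Implicit Arguments.
Unset Strict Implicit.
Unset Printing Implicit Defensive.

Export Order.TTheory GRing.Theory Num.Theory.
Export numFieldNormedType.Exports.

Local Open Scope classical_set_scope.
Local Open Scope ring_scope.

(* Point masses are entries of a row vector [p : 'rV[R]_n]; the sample space
   is ['I_n], and [p ord0 i] is the mass of the point [i]. *)
Definition prob_vector (R : realType) (n : nat) (p : 'rV[R]_n) : Prop :=
  (forall i : 'I_n, 0 <= p ord0 i) /\ \sum_(i < n) p ord0 i = 1.

Definition ordered_prob_vector (R : realType) (n : nat) (p : 'rV[R]_n) : Prop :=
  prob_vector p /\ (forall i j : 'I_n, (i <= j)%N -> p ord0 i <= p ord0 j).

(* [X] is the sample X_1, ..., X_t, hence [codom X] the set of observed
   points. *)
Definition missing_mass (R : realType) (n t : nat) (p : 'rV[R]_n)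
    (X : {ffun 'I_t -> 'I_n}) : R :=
  \sum_(i < n | i \notin codom X) p ord0 i.

(* The draws are independent with law [p], so a given sample [X] has
   probability [\prod_(j < t) p ord0 (X j)]. *)
Definition expected_missing_mass (R : realType) (n t : nat) (p : 'rV[R]_n) : R :=
  \sum_(X : {ffun 'I_t -> 'I_n}) (\prod_(j < t) p ord0 (X j)) * missing_mass p X.

Lemma expected_missing_massE (R : realType) (n t : nat) (p : 'rV[R]_n) :
  prob_vector p ->
  expected_missing_mass t p = \sum_(i < n) p ord0 i * (1 - p ord0 i) ^+ t.
Proof.
move=> [_ p1]; rewrite /expected_missing_mass /missing_mass.
under eq_bigr => X _ do rewrite big_distrr /= big_mkcond /=.
rewrite exchange_big /=; apply: eq_bigr => i _.
have -> : 1 - p ord0 i = \sum_(k < n) (if k == i then 0 else p ord0 k).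
  rewrite -p1 (bigD1 i) //= addrAC subrr add0r [RHS](bigD1 i) //= eqxx add0r.
  by apply: eq_bigr => k /negPf ->.
have -> : (\sum_(k < n) (if k == i then 0 else p ord0 k)) ^+ t =
    \prod_(j < t) \sum_(k < n) (if k == i then 0 else p ord0 k).
  by rewrite prodr_const card_ord.
rewrite bigA_distr_bigA /= big_distrr /=; apply: eq_bigr => X _.
case: ifPn => [iX|]; last first.
  rewrite negbK => /codomP[j ij].
  by rewrite (bigD1 j) //= -ij eqxx mul0r mulr0.
rewrite mulrC; congr (_ * _); apply: eq_bigr => j _.
by case: eqP => // ji; rewrite -ji codom_f in iX.
Qed.

(* The neighbourhood is relative to the simplex of all probability vectors,
   not only of the ordered ones. *)
Definition local_maximum (R : realType) (n t : nat) (p : 'rV[R]_n) : Prop :=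
  prob_vector p /\
  (\forall q \near p, prob_vector q ->
     expected_missing_mass t q <= expected_missing_mass t p).

Definition global_maximum (R : realType) (n t : nat) (p : 'rV[R]_n) : Prop :=
  prob_vector p /\
  (forall q : 'rV[R]_n, prob_vector q ->
     expected_missing_mass t q <= expected_missing_mass t p).

(* Uniqueness up to permutation of the coordinates, i.e. among ordered
   probability vectors. *)
Definition unique_global_maximum (R : realType) (n t : nat) (p : 'rV[R]_n) :
    Prop :=
  [/\ ordered_prob_vector p, global_maximum t p &
      forall q : 'rV[R]_n,
        ordered_prob_vector q -> global_maximum t q -> q = p].

(* Coordinates are numbered from 0, so that the last one is [n.-1]. *)
Definition all_but_last_equal (R : realType) (n : nat) (p : 'rV[R]_n) : Prop :=
  forall i j : 'I_n, (i < n.-1)%N -> (j < n.-1)%N -> p ord0 i = p ord0 j.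

Definition last_dominates (R : realType) (n : nat) (p : 'rV[R]_n) : Prop :=
  forall i k : 'I_n, (i < n.-1)%N -> k = n.-1 :> nat -> p ord0 i <= p ord0 k.

Definition last_strictly_dominates (R : realType) (n : nat) (p : 'rV[R]_n) :
    Prop :=
  forall i k : 'I_n, (i < n.-1)%N -> k = n.-1 :> nat -> p ord0 i < p ord0 k.

(* Main.v *)
Require Import Defs.
From mathcomp Require Import ring lra zify.

Set Implicit Arguments.
Unset Strict Implicit.
Unset Printing Implicit Defensive.

Local Open Scope classical_set_scope.
Local Open Scope ring_scope.

(** Write [f x = x (1 - x)^t] and [m = n - 1]. Since [f] is concave on
    [[0, 2/(t+1)]] and convex beyond, a local maximum has equal masses in the
    concave zone and at most one mass in the convex zone, i.e. it is
    [(a, ..., a, b)] with [b = 1 - m a].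

    A non-uniform maximum satisfies [f'(a) = f'(b)] with [1/(t+1) < a < 1/n].
    The derivative in [a] of [ln (f'(a) / f'(b))] has the sign of a quadratic
    [Q], so by Rolle two solutions [a1 < a2], together with the trivial solution
    [1/n], locate the roots of [Q] around [a2]; but the second order condition
    says [Q(a2) >= 0]. Hence [a] is unique. The same argument with
    [Q(1/(t-1)) < 0] gives [a < 1/(t-1)], and [Q] has no real root at [t = n].

    If the uniform vector is tied at [t], it is strictly beaten at [t+1], by the
    inequality [t y^(t+1) + c^(t+1) >= (t+1) c y^t]; this gives the threshold.
    Comparing the uniform vector with [a = 1/(t+1)] comes down to the sign of
    [log_gain], which is positive from [n + sqrt (2 n)] on and at most
    [- 2 (2n)^(-3/2)] slightly below, where the contribution
    [f(b) <= exp (- sqrt (2 n) + 5)] of the large mass is too small to help. *)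

(** * Calculus *)

Lemma mean_value (R : realType) (f df : R -> R) (a b : R) : a < b ->
  (forall x, a <= x <= b -> is_derive x 1 f (df x)) ->
  exists2 c, a < c < b & f b - f a = df c * (b - a).
Proof.
move=> ab fd.
have fc : {within `[a, b], continuous f}.
  apply: derivable_within_continuous => x; rewrite in_itv /= => xab.
  by case: (fd _ xab).
have fd' x : x \in `]a, b[ -> is_derive x 1 f (df x).
  by rewrite in_itv /= => /andP[ax xb]; apply: fd; rewrite !ltW.
by have [c] := MVT ab fd' fc; rewrite in_itv /= => cab e; exists c.
Qed.

Lemma lt_of_derive_pos (R : realType) (f df : R -> R) (a b : R) : a < b ->
  (forall x, a <= x <= b -> is_derive x 1 f (df x)) ->
  (forall x, a < x < b -> 0 < df x) -> f a < f b.
Proof.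
move=> ab fd dfp; have [c cab e] := mean_value ab fd.
by rewrite -subr_gt0 e mulr_gt0 ?subr_gt0 ?dfp.
Qed.

Lemma gt_of_derive_neg (R : realType) (f df : R -> R) (a b : R) : a < b ->
  (forall x, a <= x <= b -> is_derive x 1 f (df x)) ->
  (forall x, a < x < b -> df x < 0) -> f b < f a.
Proof.
move=> ab fd dfp; have [c cab e] := mean_value ab fd.
by rewrite -subr_gt0 -opprB e -mulrN opprB nmulr_rgt0 ?subr_lt0 ?dfp.
Qed.

(** One-sided, so that it also provides an improving perturbation at the boundary level [a = 0]. *)
Lemma derive_pos_right (R : realType) (f : R -> R) (a d : R) :
  is_derive a 1 f d -> 0 < d ->
  exists2 e, 0 < e & forall x, a < x < a + e -> f a < f x.
Proof.
move=> [fa fd] d0.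
have h0 : (fun h : R => h^-1 *: (f (h *: 1 + a) - f a)) h @[h --> 0^'] --> d.
  by rewrite -fd; exact: fa.
have := cvgr_gt _ h0 _ d0.
move=> hh; have [e /= e0 he] := (nbhs_ballP _ _).1 (hh _).
exists e => // x /andP[ax xae].
have hx : 0 < x - a by rewrite subr_gt0.
have := he (x - a).
rewrite /ball /= sub0r normrN gtr0_norm // ltrBlDl => /(_ xae).
rewrite gt_eqF // => /(_ isT).
rewrite /GRing.scale /= mulr1 subrK pmulr_rgt0 ?invr_gt0 //.
by rewrite subr_gt0.
Qed.

(** * The summand, its concave zone and its convex zone *)

Definition mass_term (R : realType) (t : nat) (x : R) : R := x * (1 - x) ^+ t.

(** First and second derivatives of [mass_term] in factored form; the truncated exponents make them
    valid from [t = 1] and [t = 2] on, respectively. *)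
Definition mass_term1 (R : realType) (t : nat) (x : R) : R :=
  (1 - x) ^+ t.-1 * (1 - t.+1%:R * x).

Definition mass_term2 (R : realType) (t : nat) (x : R) : R :=
  t%:R * (1 - x) ^+ t.-2 * (t.+1%:R * x - 2).

Lemma is_derive_mass_term (R : realType) (t : nat) (x : R) : (0 < t)%N ->
  is_derive x 1 (mass_term t) (mass_term1 t x).
Proof.
move=> t0; have -> : mass_term t = horner ('X * (1 - 'X) ^+ t : {poly R}).
  by apply/funext => y; rewrite /mass_term !hornerE.
apply: (is_derive_eq (is_derive_poly _ x)).
rewrite ?(poly.derivE, deriv_exp) ?(hornerMn, hornerE) /mass_term1.
case: t t0 => // t _; rewrite exprS /= ?(hornerMn, hornerE).
rewrite -[_ *+ t.+1]mulr_natr -!natr1.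
by ring.
Qed.

Lemma is_derive_mass_term1 (R : realType) (t : nat) (x : R) : (1 < t)%N ->
  is_derive x 1 (mass_term1 t) (mass_term2 t x).
Proof.
move=> t0.
have -> : mass_term1 t =
    horner ((1 - 'X) ^+ t.-1 * (1 - t.+1%:R%:P * 'X) : {poly R}).
  by apply/funext => y; rewrite /mass_term1 !hornerE.
apply: (is_derive_eq (is_derive_poly _ x)).
rewrite ?(poly.derivE, deriv_exp) ?(hornerMn, hornerE) /mass_term2.
case: t t0 => [//|[//|t]] _; rewrite exprS /= ?(hornerMn, hornerE).
rewrite -[_ *+ t.+1]mulr_natr -!natr1.
by ring.
Qed.

(** The mean value points in [[x, x + s]] and [[y - s, y]] are separated because [x + s <= y - s],
    so the gain on the left exceeds the loss on the right. *)
Lemma transfer_gain (R : realType) (f df : R -> R) (x y s : R) :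
  (forall z : R, is_derive z 1 f (df z)) -> 0 < s -> x + s <= y - s ->
  (forall u v, x <= u -> u < v -> v <= y -> df v < df u) ->
  f x + f y < f (x + s) + f (y - s).
Proof.
move=> fd s0 xy df_lt.
have [c /andP[c1 c2] ec] := mean_value (ltac:(lra) : x < x + s)
  (fun z _ => fd z).
have [e /andP[e1 e2] ee] := mean_value (ltac:(lra) : y - s < y)
  (fun z _ => fd z).
have : df e < df c by apply: df_lt; lra.
rewrite -(ltr_pM2r s0).
have -> : df e * s = f y - f (y - s) by rewrite ee; ring.
have -> : df c * s = f (x + s) - f x by rewrite ec; ring.
by lra.
Qed.

Lemma mass_term1_decr (R : realType) (t : nat) (x y : R) : (0 < t)%N ->
  0 <= x -> x < y -> t.+1%:R * y <= 2 -> mass_term1 t y < mass_term1 t x.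
Proof.
case: t => [//|[_ x0 xy _|t _ x0 xy yt]].
  (* For [t = 1] the derivative is affine, and [mass_term2] is not yet its derivative. *)
  by rewrite /mass_term1 /= !mul1r; lra.
apply: (gt_of_derive_neg xy) => [z _|z /andP[xz zy]].
  exact: is_derive_mass_term1.
have t1 : 3 <= t.+3%:R :> R by rewrite ler_nat.
have zt : t.+3%:R * z < 2.
  by apply: lt_le_trans yt; rewrite ltr_pM2l // ltr0n.
have z1 : z < 1 by nra.
rewrite /mass_term2 nmulr_llt0 ?mulr_gt0 ?exprn_gt0 ?subr_gt0 ?ltr0n //.
by rewrite subr_lt0.
Qed.

Lemma mass_term1_incr (R : realType) (t : nat) (x y : R) : (1 < t)%N ->
  2 <= t.+1%:R * x -> x < y -> y <= 1 -> mass_term1 t x < mass_term1 t y.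
Proof.
move=> t1 xt xy y1; have t0 : (0 < t)%N by apply: ltn_trans t1.
apply: (lt_of_derive_pos xy) => [z _|z /andP[xz zy]].
  exact: is_derive_mass_term1.
have zt : 2 < t.+1%:R * z.
  by apply: le_lt_trans xt _; rewrite ltr_pM2l // ltr0n.
rewrite /mass_term2 mulr_gt0 ?mulr_gt0 ?exprn_gt0 ?subr_gt0 ?ltr0n //.
exact: lt_le_trans y1.
Qed.

Lemma mass_term_contract (R : realType) (t : nat) (x y s : R) : (0 < t)%N ->
  0 <= x -> t.+1%:R * y <= 2 -> 0 < s -> x + s <= y - s ->
  mass_term t x + mass_term t y < mass_term t (x + s) + mass_term t (y - s).
Proof.
move=> t0 x0 yt s0 xy.
apply: (transfer_gain (fun z => is_derive_mass_term z t0)) => // u v xu uv vy.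
apply: mass_term1_decr => //; first exact: le_trans xu.
by apply: le_trans yt; rewrite ler_pM2l // ltr0n.
Qed.

Lemma mass_term_spread (R : realType) (t : nat) (x y s : R) : (1 < t)%N ->
  2 <= t.+1%:R * (x - s) -> y + s <= 1 -> 0 < s -> x <= y ->
  mass_term t x + mass_term t y < mass_term t (x - s) + mass_term t (y + s).
Proof.
move=> t1 xt y1 s0 xy; have t0 : (0 < t)%N by apply: ltn_trans t1.
have [c /andP[c1 c2] ec] := mean_value (ltac:(lra) : x - s < x)
  (fun z _ => is_derive_mass_term z t0).
have [e /andP[e1 e2] ee] := mean_value (ltac:(lra) : y < y + s)
  (fun z _ => is_derive_mass_term z t0).
have : mass_term1 t c < mass_term1 t e.
  apply: mass_term1_incr => //; try lra.
  by apply: le_trans xt _; rewrite ler_pM2l ?ltr0n // ltW.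
rewrite -(ltr_pM2r s0).
have -> : mass_term1 t e * s = mass_term t (y + s) - mass_term t y.
  by rewrite ee; ring.
have -> : mass_term1 t c * s = mass_term t x - mass_term t (x - s).
  by rewrite ec; ring.
by lra.
Qed.

(** * Transferring mass between two points *)

Definition transfer (R : realType) (n : nat) (p : 'rV[R]_n) (i j : 'I_n)
    (s : R) : 'rV[R]_n :=
  \row_k (p ord0 k + s * ((k == i)%:R - (k == j)%:R)).

Lemma prob_vector_transfer (R : realType) (n : nat) (p : 'rV[R]_n)
    (i j : 'I_n) (s : R) :
  prob_vector p -> 0 <= s -> s <= p ord0 j -> prob_vector (transfer p i j s).
Proof.
move=> [p0 p1] s0 sj; split=> [k|]; last first.
  under eq_bigr do rewrite mxE; rewrite big_split /= p1 -big_distrr /= sumrB.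
  have sum1 (l : 'I_n) : \sum_(k < n) (k == l)%:R = 1 :> R.
    rewrite (bigD1 l) //= eqxx big1 ?addr0 // => k /negPf -> //.
  by rewrite !sum1 subrr mulr0 addr0.
have := p0 k; rewrite mxE; case: (k == i); case: eqP => [->|_] /=;
  rewrite ?mulr1n ?mulr0n; lra.
Qed.

Lemma expected_missing_mass_transfer (R : realType) (n t : nat) (p : 'rV[R]_n)
    (i j : 'I_n) (s : R) :
  prob_vector p -> i != j -> 0 <= s -> s <= p ord0 j ->
  expected_missing_mass t (transfer p i j s) - expected_missing_mass t p =
    mass_term t (p ord0 i + s) + mass_term t (p ord0 j - s) -
    (mass_term t (p ord0 i) + mass_term t (p ord0 j)).
Proof.
move=> pp ij s0 sj; rewrite !expected_missing_massE //; last first.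
  exact: prob_vector_transfer.
rewrite -sumrB (bigD1 i) // (bigD1 j) 1?eq_sym //= big1 => [|k /andP[ki kj]].
  rewrite !mxE !eqxx (negPf ij) eq_sym (negPf ij) /mass_term.
  by rewrite subr0 sub0r mulr1 mulrN1; ring.
by rewrite mxE (negPf ki) (negPf kj) subrr mulr0 addr0 subrr.
Qed.

(** In the sup norm the transferred vector is within [s] of [p], so the radius of the neighbourhood
    of maximality serves as [e]. *)
Lemma local_maximum_transfer (R : realType) (n t : nat) (p : 'rV[R]_n)
    (i j : 'I_n) : local_maximum t p -> i != j ->
  exists2 e, 0 < e & forall s, 0 < s -> s < e -> s <= p ord0 j ->
    mass_term t (p ord0 i + s) + mass_term t (p ord0 j - s) <=
    mass_term t (p ord0 i) + mass_term t (p ord0 j).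
Proof.
move=> [pp /nbhs_ballP[e /= e0 pmax]] ij; exists e => // s s0 se sj.
rewrite -subr_le0 -(expected_missing_mass_transfer t pp ij (ltW s0) sj).
rewrite subr_le0; apply: pmax; last exact: prob_vector_transfer (ltW s0) _.
split=> // k l; rewrite /ball /= (ord1 k) mxE opprD addrA subrr sub0r normrN.
apply: le_lt_trans se; rewrite normrM gtr0_norm //.
by rewrite ler_piMr ?(ltW s0) //; do 2 case: eqP => _;
  rewrite ?subrr ?subr0 ?sub0r ?normrN ?normr1 ?normr0.
Qed.

Lemma prob_vector_le1 (R : realType) (n : nat) (p : 'rV[R]_n) (i j : 'I_n) :
  prob_vector p -> i != j -> p ord0 i + p ord0 j <= 1.
Proof.
move=> [p0 <-] ij; rewrite (bigD1 i) // (bigD1 j) 1?eq_sym //= addrA.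
by rewrite lerDl sumr_ge0.
Qed.

(* Mass moves towards equality where the summand is concave, and away from it
   where the summand is convex. *)
Lemma local_maximum_shape (R : realType) (n t : nat) (p : 'rV[R]_n) :
  (0 < t)%N -> ordered_prob_vector p -> local_maximum t p ->
  all_but_last_equal p.
Proof.
move=> t0 [pp pord] pmax i j ilt jlt; wlog ij : i j ilt jlt / (i <= j)%N.
  by move=> W; case: (leqP i j) => [|/ltnW] ij; [exact: W|exact/esym/W].
apply/eqP; move: (pord _ _ ij); rewrite le_eqVlt => /predU1P[/eqP//|pij].
have nij : i != j by apply: contraTneq pij => ->; rewrite ltxx.
(* If [j], hence [i], is in the concave zone, moving at most half the gap from [j] to [i] improves
   the objective. *)
have [jc|jc] := leP (t.+1%:R * p ord0 j) 2.
  have [e e0 noimp] := local_maximum_transfer pmax nij.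
  pose s := Num.min (e / 2) ((p ord0 j - p ord0 i) / 2).
  have s1 : 0 < s by rewrite lt_min; lra.
  have s2 : s <= e / 2 by rewrite ge_min lexx.
  have s3 : s <= (p ord0 j - p ord0 i) / 2 by rewrite ge_min lexx orbT.
  have pi0 := pp.1 i.
  have := @mass_term_contract R t (p ord0 i) (p ord0 j) s t0 pi0 jc s1
    (ltac:(lra)).
  have := noimp s s1 (ltac:(lra)) (ltac:(lra)).
  by lra.
(* Now [j] is strictly inside the convex zone and is not last: mass is moved from [j] to the last
   point [l]. *)
have n0 : (n.-1 < n)%N by rewrite ltn_predL; exact: leq_ltn_trans (ltn_ord j).
pose l := Ordinal n0.
have jl : (j <= l)%N by exact: ltnW.
have njl : l != j by rewrite -val_eqE /= neq_ltn jlt orbT.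
have [e e0 noimp] := local_maximum_transfer pmax njl.
have plj := pord _ _ jl.
have pl1 := prob_vector_le1 pp njl.
(* For [t = 1] the convex zone would start at mass 1, which [j] cannot exceed. *)
have t1 : (1 < t)%N.
  case: t t0 jc {pmax noimp} => [//|[|//]] _ jc.
  have := pp.1 i; move: pij plj pl1 jc; lra.
have tp : 0 < t.+1%:R :> R by rewrite ltr0n.
(* [c] is the inflection point [2 / (t + 1)]; the amount moved leaves at least [c] at [j]. *)
have [c cj [c0 cE]] : exists2 c, c < p ord0 j &
    0 < c /\ forall x, c <= x -> 2 <= t.+1%:R * x.
  exists (2 / t.+1%:R); first by rewrite ltr_pdivrMr // mulrC.
  by split=> [|x]; rewrite ?divr_gt0 // ler_pdivrMr // mulrC.
pose s := Num.min (e / 2) (p ord0 j - c).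
have s1 : 0 < s by rewrite lt_min; apply/andP; split; lra.
have s2 : s <= e / 2 by rewrite ge_min lexx.
have s3 : s <= p ord0 j - c by rewrite ge_min lexx orbT.
have s4 : 2 <= t.+1%:R * (p ord0 j - s) by apply: cE; lra.
have := @mass_term_spread R t (p ord0 j) (p ord0 l) s t1 s4
    (ltac:(lra)) s1 plj.
have := noimp s s1 (ltac:(lra)) (ltac:(lra)).
by lra.
Qed.

(** * Existence of maximizers and reduction to ordered vectors *)

Lemma continuous_coord_sum (R : realType) (n : nat) (f : R -> R) :
  continuous f -> continuous (fun p : 'rV[R]_n => \sum_(i < n) f (p ord0 i)).
Proof.
move=> cf; apply: continuous_big => [|i _ p]; first exact: add_continuous.
by apply: continuous_comp; [exact: coord_continuous|exact: cf].
Qed.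

Lemma continuous_mass_term (R : realType) (t : nat) :
  continuous (@mass_term R t).
Proof.
have -> : @mass_term R t = horner ('X * (1 - 'X) ^+ t).
  by apply/funext => y; rewrite /mass_term !hornerE.
exact: continuous_horner.
Qed.

Lemma prob_vector_const (R : realType) (n : nat) : (0 < n)%N ->
  prob_vector (const_mx n%:R^-1 : 'rV[R]_n).
Proof.
move=> n0; split=> [i|]; first by rewrite mxE invr_ge0.
under eq_bigr do rewrite mxE.
by rewrite sumr_const card_ord -[LHS]mulr_natr mulVf // pnatr_eq0 -lt0n.
Qed.

Lemma expected_missing_mass_const (R : realType) (n t : nat) : (0 < n)%N ->
  expected_missing_mass t (const_mx n%:R^-1 : 'rV[R]_n) = (1 - n%:R^-1) ^+ t.
Proof.
move=> n0; rewrite expected_missing_massE; last exact: prob_vector_const.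
under eq_bigr do rewrite mxE.
rewrite sumr_const card_ord -[LHS]mulr_natr mulrAC mulVf ?mul1r //.
by rewrite pnatr_eq0 -lt0n.
Qed.

(** The simplex is closed in a compact cube, and on it the objective agrees with a continuous
    coordinate sum. *)
Lemma exists_global_maximum (R : realType) (n t : nat) : (0 < n)%N ->
  exists p : 'rV[R]_n, global_maximum t p.
Proof.
move=> n0.
pose A := [set p : 'rV[R]_n | forall i, `[0, 1]%classic (p ord0 i)] `&`
  ((fun p : 'rV[R]_n => \sum_(i < n) p ord0 i) @^-1` [set x | x = 1]).
have AE p : prob_vector p <-> A p.
  split=> [[p0 p1]|[p0 p1]]; split=> // i; last first.
    by have /andP[] := p0 i.
  rewrite /= in_itv /= p0 /= -p1 (bigD1 i) //= lerDl sumr_ge0 //.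
have cA : compact A.
  apply: compact_closedI.
    exact: (@rV_compact R n (fun=> `[0, 1]%classic)
      (fun=> @segment_compact R 0 1)).
  apply: (@preimage_closed _ _ (fun p : 'rV[R]_n => \sum_(i < n) p ord0 i)).
    by move=> p _; apply: (@continuous_coord_sum R n id) => x; exact: cvg_id.
  exact: closed_eq.
have A0 : A !=set0 by exists (const_mx n%:R^-1); apply/AE/prob_vector_const.
have [|p Ap pmax] := @EVT_max_rV R n
    (fun p => \sum_(i < n) mass_term t (p ord0 i)) A A0 cA.
  apply: continuous_subspaceT; apply: continuous_coord_sum.
  exact: continuous_mass_term.
move: Ap; rewrite inE => /AE Ap.
exists p; split=> // q qq; rewrite !expected_missing_massE //.
by apply: pmax; rewrite inE; apply/AE.
Qed.

Lemma global_maximum_local (R : realType) (n t : nat) (p : 'rV[R]_n) :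
  global_maximum t p -> local_maximum t p.
Proof.
by move=> [pp pmax]; split=> //; near=> q => /pmax.
Unshelve. all: end_near. Qed.

(** Quantifying over [g] says that [p] rearranges [q] without naming a permutation; the objective,
    nonnegativity and constancy are carried over by suitable choices of [g]. *)
Lemma sort_row (R : realType) (n : nat) (q : 'rV[R]_n) :
  exists2 p : 'rV[R]_n,
    forall i j : 'I_n, (i <= j)%N -> p ord0 i <= p ord0 j &
    forall g : R -> R, \sum_(i < n) g (p ord0 i) = \sum_(i < n) g (q ord0 i).
Proof.
pose s := sort <=%R [seq q ord0 i | i <- enum 'I_n].
have szs : size s = n by rewrite size_sort size_map size_enum_ord.
exists (\row_i nth 0 s i) => [i j ij|g].
  rewrite !mxE; apply: (@le_sorted_leq_nth _ _ 0 s) => //; rewrite ?inE ?szs //.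
  exact: sort_le_sorted.
under eq_bigr do rewrite mxE.
rewrite -(big_mkord xpredT (fun i => g (nth 0 s i))) /=.
rewrite -{1}szs -(big_nth 0 xpredT) (perm_big _ (permEl (perm_sort _ _))) /=.
by rewrite big_map big_enum.
Qed.

Lemma sorted_global_maximum (R : realType) (n t : nat) (q : 'rV[R]_n) :
  global_maximum t q -> exists p : 'rV[R]_n,
    [/\ ordered_prob_vector p, global_maximum t p &
        forall c, p = const_mx c -> q = const_mx c].
Proof.
move=> [[q0 q1] qmax]; have [p pord pq] := sort_row q.
have pp : prob_vector p.
  split; last by rewrite (pq id).
  have : \sum_(i < n) (p ord0 i < 0)%R%:R = 0 :> R.
    rewrite (pq (fun x => (x < 0)%R%:R)) big1 // => i _.
    by rewrite ltNge q0.
  move=> /eqP; rewrite psumr_eq0 // => /allP p0 i.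
  by have := p0 i (mem_index_enum _); rewrite pnatr_eq0 eqb0 -leNgt.
have Epq : expected_missing_mass t p = expected_missing_mass t q.
  by rewrite !expected_missing_massE ?(pq (mass_term t)).
exists p; split=> // [|c pc].
  by split=> // r /qmax; rewrite Epq.
apply/rowP => i; rewrite mxE; apply/eqP; rewrite -subr_eq0 -sqrf_eq0.
have : \sum_(i < n) (q ord0 i - c) ^+ 2 = 0.
  rewrite -(pq (fun x => (x - c) ^+ 2)) big1 // => j _.
  by rewrite pc mxE subrr expr0n.
move=> /eqP; rewrite psumr_eq0 => [|j _]; last exact: sqr_ge0.
by move=> /allP/(_ i (mem_index_enum _)).
Qed.

(** * Critical points of two-level vectors *)

Lemma is_derive_affine_comp (R : realType) (f : R -> R) (u v x d : R) :
  is_derive (u * x + v) 1 f d ->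
  is_derive x 1 (fun y : R => f (u * y + v)) (u * d).
Proof.
move=> fd; rewrite mulrC.
have ad : is_derive x 1 (fun y : R => u * y + v) u.
  have -> : (fun y : R => u * y + v) = horner (u *: 'X + v%:P).
    by apply/funext => y; rewrite !hornerE.
  apply: (is_derive_eq (is_derive_poly _ x)).
  by rewrite !poly.derivE !hornerE.
exact: (@is_derive1_comp R f (fun y => u * y + v)).
Qed.

Definition two_level_mass (R : realType) (m t : nat) (x : R) : R :=
  m%:R * mass_term t x + mass_term t (1 - m%:R * x).

(** The coefficients are free so that one rule differentiates both [two_level_mass] ([e = 1]) and
    its derivative ([e = - m]). *)
Lemma is_derive_two_level (R : realType) (f df : R -> R) (c e m x : R) :
  (forall y : R, is_derive y 1 f (df y)) ->
  is_derive x 1 (fun y => c * f y + e * f (1 - m * y))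
    (c * df x - e * m * df (1 - m * x)).
Proof.
move=> fd.
have d1 : is_derive x 1 (fun y : R => f (- m * y + 1)) (- m * df (- m * x + 1)).
  exact: is_derive_affine_comp.
have d2 := is_deriveD (is_deriveZ c (fd x)) (is_deriveZ e d1).
have -> : (fun y => c * f y + e * f (1 - m * y)) =
    c \*: f + e \*: (fun y : R => f (- m * y + 1)).
  by apply/funext => y; congr (c * f y + e * f _); ring.
apply: (is_derive_eq d2); rewrite /GRing.scale /= !mulNr [_ + 1]addrC.
by rewrite mulrN mulrA.
Qed.

Lemma is_derive_two_level_mass (R : realType) (m t : nat) (x : R) : (0 < t)%N ->
  is_derive x 1 (@two_level_mass R m t)
    (m%:R * mass_term1 t x - m%:R * mass_term1 t (1 - m%:R * x)).
Proof.
move=> t0; have -> : @two_level_mass R m t =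
    fun y => m%:R * mass_term t y + 1 * mass_term t (1 - m%:R * y).
  by apply/funext => y; rewrite mul1r.
rewrite -[X in _ - X * _]mul1r; apply: is_derive_two_level => y.
exact: is_derive_mass_term.
Qed.

Lemma is_derive_two_level_mass1 (R : realType) (m t : nat) (x : R) :
  (1 < t)%N ->
  is_derive x 1
    (fun y => m%:R * mass_term1 t y - m%:R * mass_term1 t (1 - m%:R * y))
    (m%:R * (mass_term2 t x + m%:R * mass_term2 t (1 - m%:R * x))).
Proof.
move=> t1; have -> :
    (fun y => m%:R * mass_term1 t y - m%:R * mass_term1 t (1 - m%:R * y)) =
    fun y : R => m%:R * mass_term1 t y + (- m%:R) * mass_term1 t (1 - m%:R * y).
  by apply/funext => y; rewrite mulNr.
have d1 := @is_derive_two_level R (mass_term1 t) (mass_term2 t) m%:R (- m%:R)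
  m%:R x (fun y => is_derive_mass_term1 y t1).
by apply: (is_derive_eq d1); ring.
Qed.

(** In the concave zone the derivative decreases. If [y] is beyond it, the derivative is nonnegative
    at [x] and nonpositive at [y], and one sign is strict: at [x] if [x = 0], at [y] otherwise. The
    case [y = 1] is needed because [1 - m a = 1] when [a = 0]. *)
Lemma mass_term1_gt (R : realType) (t : nat) (x y : R) : (1 < t)%N ->
  0 <= x -> t.+1%:R * x <= 1 -> x < y -> (0 < x -> y < 1) -> y <= 1 ->
  mass_term1 t y < mass_term1 t x.
Proof.
move=> t1 x0 xt xy y1' y1; have [yt|yt] := leP (t.+1%:R * y) 2.
  by apply: mass_term1_decr => //; apply: ltn_trans t1.
have xlt1 : x < 1 by apply: lt_le_trans y1.
move: x0; rewrite le_eqVlt => /predU1P[x0|x0].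
  apply: (@le_lt_trans _ _ 0).
    by rewrite /mass_term1 mulr_ge0_le0 ?exprn_ge0; lra.
  by rewrite /mass_term1 -x0 subr0 expr1n mulr0 subr0 mulr1.
apply: (@lt_le_trans _ _ 0).
  have := y1' x0 => yl.
  by rewrite /mass_term1 pmulr_rlt0 ?exprn_gt0; lra.
by rewrite /mass_term1 mulr_ge0 ?exprn_ge0; lra.
Qed.

(** If [(t + 1) a <= 1], the small masses have a larger derivative than the large one, and raising
    [a] gains. Hence [a] is interior and critical, and a positive second derivative would make the
    first one positive just to the right of [a]. *)
Lemma two_level_max_conditions (R : realType) (m t : nat) (a : R) :
  (0 < m)%N -> (1 < t)%N -> 0 <= a -> m.+1%:R * a < 1 ->
  (forall x, 0 <= x -> m%:R * x <= 1 ->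
     two_level_mass m t x <= two_level_mass m t a) ->
  [/\ 1 < t.+1%:R * a,
      mass_term1 t a = mass_term1 t (1 - m%:R * a) &
      mass_term2 t a + m%:R * mass_term2 t (1 - m%:R * a) <= 0].
Proof.
move=> m0 t1 a0; rewrite -natr1 mulrDl mul1r => am amax.
have t0 : (0 < t)%N by apply: ltn_trans t1.
have mp : 0 < m%:R :> R by rewrite ltr0n.
have tp : 0 < t.+1%:R :> R by rewrite ltr0n.
(* [a + e1 = 1 / m] is the level at which the last mass vanishes. *)
pose e1 := (1 - m%:R * a) / m%:R.
have e1p : 0 < e1 by rewrite divr_gt0 //; lra.
have e1E x : x <= a + e1 -> m%:R * x <= 1.
  move=> xe; apply: (@le_trans _ _ (m%:R * (a + e1))); first by rewrite ler_pM2l.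
  rewrite mulrDr [m%:R * e1]mulrC divfK ?gt_eqF //; lra.
have ta : 1 < t.+1%:R * a.
  rewrite ltNge; apply/negP => ta.
  have dp : 0 < m%:R * mass_term1 t a - m%:R * mass_term1 t (1 - m%:R * a).
    rewrite -mulrBr mulr_gt0 // subr_gt0; apply: mass_term1_gt => //; last nra.
      by lra.
    by move=> ap; have := mulr_gt0 mp ap; lra.
  have [e e0 ge] := derive_pos_right (is_derive_two_level_mass m a t0) dp.
  pose s := Num.min (e / 2) e1.
  have sp : 0 < s by rewrite lt_min e1p andbT; lra.
  have se : s <= e / 2 by rewrite ge_min lexx.
  have se1 : s <= e1 by rewrite ge_min lexx orbT.
  have := ge (a + s); rewrite ltrDl sp ltrD2l => /(_ (ltac:(lra))).
  by rewrite ltNge amax //; [lra|apply: e1E; lra].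
have ap : 0 < a by rewrite -(pmulr_rgt0 _ tp); lra.
have fo : mass_term1 t a = mass_term1 t (1 - m%:R * a).
  have lt0 : 0 < a + e1 by lra.
  have ain : a \in `]0, a + e1[ by rewrite in_itv /= ap; lra.
  have fd x : x \in `]0, a + e1[ -> derivable (two_level_mass m t) x 1.
    by move=> _; case: (is_derive_two_level_mass m x t0).
  have fmax x : x \in `]0, a + e1[ ->
      two_level_mass m t x <= two_level_mass m t a.
    rewrite in_itv /= => /andP[x0 xe].
    by apply: amax; [lra|apply: e1E; lra].
  have [_] := derive1_at_max (ltW lt0) fd ain fmax.
  case: (is_derive_two_level_mass m a t0) => _ -> /eqP.
  by rewrite -mulrBr mulf_eq0 gt_eqF //= subr_eq0 => /eqP.
split=> //; rewrite leNgt; apply/negP => so.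
have dp := mulr_gt0 mp so.
have [e e0 ge] := derive_pos_right (is_derive_two_level_mass1 m a t1) dp.
pose s := Num.min (e / 2) e1.
have sp : 0 < s by rewrite lt_min e1p andbT; lra.
have se : s <= e / 2 by rewrite ge_min lexx.
have se1 : s <= e1 by rewrite ge_min lexx orbT.
have : two_level_mass m t a < two_level_mass m t (a + s).
  apply: (lt_of_derive_pos _ (fun x _ => is_derive_two_level_mass m x t0)).
    by lra.
  move=> x /andP[ax xs].
  have := ge x; rewrite ax fo subrr => /(_ _); apply; lra.
by rewrite ltNge amax //; [lra|apply: e1E; lra].
Qed.

(* The sign of the derivative of [log_ratio], see [is_derive_log_ratio]. *)
Definition crit_quad (R : realType) (m t x : R) : R :=
  (t + 1) * (m * t - 1) * x ^+ 2 - (t + 1) * (t + m - 2) * x + (t - 1).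

(** Strict convexity: [E] writes the quadratic as its chord minus the leading coefficient times a
    positive product. *)
Lemma crit_quad_between (R : realType) (m t x y z : R) :
  0 < (t + 1) * (m * t - 1) -> x < y -> y < z ->
  crit_quad m t x <= 0 -> crit_quad m t z <= 0 -> crit_quad m t y < 0.
Proof.
move=> lead xy yz qx qz.
have E : (z - x) * crit_quad m t y = (z - y) * crit_quad m t x +
    (y - x) * crit_quad m t z -
    (t + 1) * (m * t - 1) * ((y - x) * (z - y) * (z - x)).
  by rewrite /crit_quad; ring.
rewrite -(pmulr_rlt0 _ (_ : 0 < z - x)); last by lra.
have h1 : (z - y) * crit_quad m t x <= 0 by rewrite mulr_ge0_le0 //; lra.
have h2 : (y - x) * crit_quad m t z <= 0 by rewrite mulr_ge0_le0 //; lra.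
have h3 : 0 < (t + 1) * (m * t - 1) * ((y - x) * (z - y) * (z - x)).
  by apply: mulr_gt0 => //; rewrite !mulr_gt0 //; lra.
by rewrite E; lra.
Qed.

(** By [f2] the second derivative is a rational multiple of the first. As the first derivative takes
    the same value [- K < 0] at both levels, clearing positive denominators turns the second order
    condition into [- t K m Q(a) <= 0]. *)
Lemma crit_quad_max (R : realType) (m t : nat) (a : R) :
  (0 < m)%N -> (1 < t)%N -> 1 < t.+1%:R * a -> m.+1%:R * a < 1 ->
  mass_term1 t a = mass_term1 t (1 - m%:R * a) ->
  mass_term2 t a + m%:R * mass_term2 t (1 - m%:R * a) <= 0 ->
  0 <= crit_quad m%:R t%:R a.
Proof.
move=> m0 t1; rewrite -[m.+1%:R]natr1 mulrDl mul1r => ta am fo so.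
have tp : 0 < t.+1%:R :> R by rewrite ltr0n.
have mp : 0 < m%:R :> R by rewrite ltr0n.
have ap : 0 < a by rewrite -(pmulr_rgt0 _ tp); lra.
pose b : R := 1 - m%:R * a; rewrite -/b in fo so.
have b1 : 1 - b = m%:R * a by rewrite /b; ring.
have map := mulr_gt0 mp ap.
have ab : a < b by rewrite /b; lra.
have tb : 1 < t.+1%:R * b by apply: lt_le_trans ta _; rewrite ler_pM2l // ltW.
have tn0 : 0 < t%:R :> R by rewrite ltr0n; apply: ltn_trans t1.
pose A : R := t.+1%:R * a - 1; pose B : R := t.+1%:R * b - 1.
have Ap : 0 < A by rewrite subr_gt0.
have Bp : 0 < B by rewrite subr_gt0.
pose K := - mass_term1 t a.
have Kp : 0 < K.
  rewrite /K /mass_term1 -mulrN opprB mulr_gt0 // exprn_gt0 //; lra.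
have f2 (x : R) : mass_term2 t x * ((1 - x) * (t.+1%:R * x - 1)) =
    t%:R * (- mass_term1 t x) * (t.+1%:R * x - 2).
  rewrite /mass_term2 /mass_term1; case: (t) t1 => [//|[//|k]] _ /=.
  by rewrite exprS; ring.
have fa := f2 a; have fb := f2 b.
rewrite -/K -/A in fa; rewrite -fo -/K -/B b1 in fb.
have : (mass_term2 t a + m%:R * mass_term2 t b) *
    ((1 - a) * (m%:R * a) * A * B) <= 0.
  by rewrite mulr_le0_ge0 // !mulr_ge0 ?(ltW map) ?(ltW Ap) ?(ltW Bp) //; lra.
have -> : (mass_term2 t a + m%:R * mass_term2 t b) *
    ((1 - a) * (m%:R * a) * A * B) =
    (mass_term2 t a * ((1 - a) * A)) * (m%:R * a * B) +
    (mass_term2 t b * (m%:R * a * B)) * (m%:R * (1 - a) * A) by ring.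
have -> : (mass_term2 t a * ((1 - a) * A)) * (m%:R * a * B) +
    (mass_term2 t b * (m%:R * a * B)) * (m%:R * (1 - a) * A) =
    - (t%:R * K * m%:R * crit_quad m%:R t%:R a).
  rewrite fa fb /A /B /b /crit_quad -[t.+1%:R]natr1; ring.
by rewrite oppr_le0 pmulr_rge0 // !mulr_gt0.
Qed.

(* The logarithm of [f'(x) / f'(1 - m x)], kept as a combination of [ln]'s of
   affine maps; it vanishes at the critical points of [two_level_mass]. *)
Definition log_ratio (R : realType) (m t x : R) : R :=
  (t - 1) * (ln (- 1 * x + 1) - ln (m * x + 0)) + ln ((t + 1) * x + - 1) -
  ln (- ((t + 1) * m) * x + t).

Lemma is_derive_log_ratio (R : realType) (m t x : R) :
  0 < m -> 0 < x -> x < 1 -> 1 < (t + 1) * x -> (t + 1) * m * x < t ->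
  is_derive x 1 (log_ratio m t)
    (t * crit_quad m t x /
     (x * (1 - x) * ((t + 1) * x - 1) * (t - (t + 1) * m * x))).
Proof.
move=> m0 x0 x1 tx tmx.
have d u v : 0 < u * x + v ->
    is_derive x 1 (fun y => ln (u * y + v)) (u * (u * x + v)^-1).
  by move=> h; apply: is_derive_affine_comp; exact: is_derive1_ln.
have mx := mulr_gt0 m0 x0.
have h1 : 0 < - 1 * x + 1 by lra.
have h2 : 0 < m * x + 0 by lra.
have h3 : 0 < (t + 1) * x + - 1 by lra.
have h4 : 0 < - ((t + 1) * m) * x + t by rewrite mulNr; lra.
have dd := is_deriveB (is_deriveD (is_deriveZ (t - 1)
  (is_deriveB (d _ _ h1) (d _ _ h2))) (d _ _ h3)) (d _ _ h4).
apply: (is_derive_eq dd); rewrite /GRing.scale /= /crit_quad.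
by field; rewrite ?gt_eqF //=; lra.
Qed.

Lemma log_ratio_eq0 (R : realType) (m t : nat) (x : R) :
  (0 < m)%N -> (1 < t)%N -> 0 < x -> x < 1 -> 1 < t.+1%:R * x ->
  t.+1%:R * m%:R * x < t%:R ->
  mass_term1 t x = mass_term1 t (1 - m%:R * x) ->
  log_ratio m%:R t%:R x = 0.
Proof.
move=> m0 t1 x0 x1 tx tmx.
have mp : 0 < m%:R :> R by rewrite ltr0n.
have mx := mulr_gt0 mp x0.
rewrite /mass_term1.
have -> : 1 - (1 - m%:R * x) = m%:R * x by ring.
move=> fo.
(* Both derivatives are negative, so the sign is flipped before taking logarithms. *)
have {fo} : (1 - x) ^+ t.-1 * (t.+1%:R * x - 1) =
    (m%:R * x) ^+ t.-1 * (t%:R - t.+1%:R * m%:R * x).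
  by rewrite -[LHS]opprK -mulrN opprB fo -natr1; ring.
have e1 : t.-1%:R = t%:R - 1 :> R by rewrite -subn1 natrB // ltnW.
move=> /(congr1 (@ln R)); rewrite !lnM ?posrE ?exprn_gt0 ?subr_gt0 //.
rewrite !lnXn ?subr_gt0 // -[ln (1 - x) *+ _]mulr_natr.
rewrite -[ln (m%:R * x) *+ _]mulr_natr e1 => E.
rewrite /log_ratio natr1 mulN1r addr0 [- x + 1]addrC mulNr [- _ + t%:R]addrC.
move: E; lra.
Qed.

(** [log_ratio] vanishes at both ends, and its derivative is [crit_quad] times a positive factor.
    The non-strict bound on [y] admits the uniform point [1 / (m + 1)]. *)
Lemma crit_quad_rolle (R : realType) (m t : nat) (x y : R) :
  (0 < m)%N -> (1 < t)%N -> x < y -> 1 < t.+1%:R * x -> m.+1%:R * y <= 1 ->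
  mass_term1 t x = mass_term1 t (1 - m%:R * x) ->
  mass_term1 t y = mass_term1 t (1 - m%:R * y) ->
  exists2 r, x < r < y & crit_quad m%:R t%:R r = 0.
Proof.
move=> m0 t1 xy tx my fx fy.
have tp : 0 < t.+1%:R :> R by rewrite ltr0n.
have mp : 0 < m%:R :> R by rewrite ltr0n.
have xp : 0 < x by rewrite -(pmulr_rgt0 _ tp); lra.
have tz z : x <= z -> 1 < t.+1%:R * z.
  by move=> xz; apply: lt_le_trans tx _; rewrite ler_pM2l.
have mz z : z <= y -> m%:R * z + z <= 1.
  move=> zy; rewrite -[X in _ + X <= _]mul1r -mulrDl natr1.
  by apply: le_trans my; rewrite ler_pM2l // ltr0n.
have z1 z : x <= z -> z <= y -> z < 1.
  move=> xz zy; have := mz _ zy; have : 0 < m%:R * z by rewrite mulr_gt0 //; lra.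
  by lra.
have tmz z : x <= z -> z <= y -> t.+1%:R * m%:R * z < t%:R.
  move=> xz zy; have := ler_wpM2l (ltW tp) (mz _ zy).
  rewrite mulrDr mulrA mulr1 => h; have := tz _ xz.
  by move: h; rewrite -[t.+1%:R]natr1; lra.
have [z /andP[xz zy]] := mean_value xy (fun z (h : x <= z <= y) =>
  is_derive_log_ratio mp
   (ltac:(case/andP: h; lra) : 0 < z)
   (ltac:(case/andP: h; exact: z1) : z < 1)
   (ltac:(rewrite natr1; case/andP: h => h _; exact: tz) : 1 < (t%:R + 1) * z)
   (ltac:(rewrite natr1; case/andP: h; exact: tmz) :
     (t%:R + 1) * m%:R * z < t%:R)).
rewrite !log_ratio_eq0 //;
  try (by [lra|apply: z1; lra|apply: tz; lra|apply: tmz; lra]).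
rewrite subrr => /esym/eqP; rewrite mulf_eq0 orbC subr_eq0 gt_eqF //= => /eqP h.
exists z; first by rewrite xz.
have xz' := ltW xz; have zy' := ltW zy.
have zp : 0 < z by lra.
have := z1 z xz' zy'; have := tz z xz'; have := tmz z xz' zy' => h1 h2 h3.
move/eqP: h; rewrite mulf_eq0 mulf_eq0 invr_eq0 !mulf_eq0.
have tn0 : t%:R != 0 :> R by rewrite pnatr_eq0 -lt0n; apply: ltn_trans t1.
rewrite (negPf tn0) /= natr1 (gt_eqF zp) [1 - z == 0]gt_eqF ?subr_gt0 //.
rewrite [_ * z - 1 == 0]gt_eqF ?subr_gt0 // [_ - _ == 0]gt_eqF ?subr_gt0 //.
by rewrite !orbF => /eqP.
Qed.

(** * Two-level vectors and the levels of nonuniform maxima *)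

Definition two_level (R : realType) (m : nat) (x : R) : 'rV[R]_m.+1 :=
  \row_i (if (i < m)%N then x else 1 - m%:R * x).

Lemma sum_two_level (R : realType) (m : nat) (x : R) (g : R -> R) :
  \sum_(i < m.+1) g (two_level m x ord0 i) = m%:R * g x + g (1 - m%:R * x).
Proof.
rewrite big_ord_recr /= mxE ltnn; congr (_ + _).
under eq_bigr do rewrite mxE /= ltn_ord.
by rewrite sumr_const card_ord mulr_natl.
Qed.

Lemma prob_vector_two_level (R : realType) (m : nat) (x : R) :
  0 <= x -> m%:R * x <= 1 -> prob_vector (two_level m x).
Proof.
move=> x0 mx; split=> [i|]; first by rewrite mxE; case: ifP => // _; lra.
by rewrite (sum_two_level m x id) addrC subrK.
Qed.

Lemma expected_missing_mass_two_level (R : realType) (m t : nat) (x : R) :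
  0 <= x -> m%:R * x <= 1 ->
  expected_missing_mass t (two_level m x) = two_level_mass m t x.
Proof.
move=> x0 mx; rewrite expected_missing_massE; last exact: prob_vector_two_level.
exact: (sum_two_level m x (mass_term t)).
Qed.

Lemma ordered_all_but_last_equal (R : realType) (m : nat) (p : 'rV[R]_m.+1) :
  (0 < m)%N -> ordered_prob_vector p -> all_but_last_equal p ->
  p = two_level m (p ord0 ord0) /\ m.+1%:R * p ord0 ord0 <= 1.
Proof.
move=> m0 [[p0 p1] pord] peq; set a : R := p ord0 ord0.
have pa (i : 'I_m.+1) : (i < m)%N -> p ord0 i = a by move=> im; apply: peq.
have pl : p ord0 ord_max = 1 - m%:R * a.
  move: p1; rewrite big_ord_recr /= (eq_bigr (fun=> a)) => [|i _]; last first.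
    by apply: pa => /=; exact: ltn_ord.
  rewrite sumr_const card_ord -[_ *+ m]mulr_natl; lra.
split.
  apply/rowP => i; rewrite mxE; case: ltnP => [|mi]; first exact: pa.
  rewrite -pl; congr (p _ _); apply/val_inj/eqP => /=.
  by rewrite eqn_leq mi -ltnS ltn_ord.
have := pord ord0 ord_max isT; rewrite pl -/a -natr1; lra.
Qed.

(* The value shared by the first [m] coordinates of a maximizer other than the
   uniform vector on [m.+1] points. *)
Definition nonuniform_level (R : realType) (m t : nat) (a : R) : Prop :=
  [/\ 1 < t.+1%:R * a, m.+1%:R * a < 1,
      mass_term1 t a = mass_term1 t (1 - m%:R * a) &
      0 <= crit_quad m%:R t%:R a].

Lemma nonuniform_maximum (R : realType) (m t : nat) (p : 'rV[R]_m.+1) :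
  (0 < m)%N -> (1 < t)%N -> ordered_prob_vector p -> global_maximum t p ->
  p <> const_mx m.+1%:R^-1 ->
  p = two_level m (p ord0 ord0) /\ nonuniform_level m t (p ord0 ord0).
Proof.
move=> m0 t1 pord pmax pnu; have t0 : (0 < t)%N by apply: ltn_trans t1.
have := local_maximum_shape t0 pord (global_maximum_local pmax).
move=> /(ordered_all_but_last_equal m0 pord)[]; set a : R := p ord0 ord0 => pE ale.
split=> //.
have a0 : 0 <= a by apply: pord.1.1.
have np : 0 < m.+1%:R :> R by rewrite ltr0n.
have am : m.+1%:R * a < 1.
  rewrite lt_neqAle ale andbT; apply/eqP => a1; apply: pnu.
  have aE : a = m.+1%:R^-1.
    by apply: (mulfI (lt0r_neq0 np)); rewrite a1 mulfV ?gt_eqF.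
  rewrite pE; apply/rowP => i; rewrite !mxE; case: ifP => // _.
  by move: a1; rewrite -aE -natr1; lra.
have ma : m%:R * a <= 1 by move: ale; rewrite -natr1; lra.
have Gmax x : 0 <= x -> m%:R * x <= 1 ->
    two_level_mass m t x <= two_level_mass m t a.
  move=> x0 mx; rewrite -!expected_missing_mass_two_level // -pE.
  by apply: pmax.2; exact: prob_vector_two_level.
have [ta fo so] := two_level_max_conditions m0 t1 a0 am Gmax.
by split=> //; exact: crit_quad_max.
Qed.

Lemma crit_quad_lead (R : realType) (m t : nat) : (0 < m)%N -> (m < t)%N ->
  0 < (t%:R + 1) * (m%:R * t%:R - 1) :> R.
Proof.
move=> m0 mt; have : 1 <= m%:R :> R by rewrite ler1n.
have : m%:R + 1 <= t%:R :> R by rewrite natr1 ler_nat.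
by move=> h1 h2; apply: mulr_gt0; nra.
Qed.

Lemma nonuniform_level_lt (R : realType) (m t : nat) (a : R) :
  nonuniform_level m t a -> (m < t)%N.
Proof.
move=> [ta am _ _]; rewrite -ltnS -(ltr_nat R).
have ap : 0 < a.
  by rewrite -(pmulr_rgt0 _ (_ : 0 < t.+1%:R)) ?ltr0n //; lra.
by rewrite -(ltr_pM2r ap); lra.
Qed.

Lemma uniform_critical (R : realType) (m t : nat) :
  mass_term1 t m.+1%:R^-1 = mass_term1 t (1 - m%:R * m.+1%:R^-1) :> R.
Proof.
congr mass_term1; have np : m.+1%:R != 0 :> R by rewrite pnatr_eq0.
by apply: (mulfI np); rewrite mulrBr mulrCA mulfV // -natr1; ring.
Qed.

(* The uniform vector is a further critical point, so two levels [a1 < a2]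
   would put [a2] strictly between two roots of [crit_quad]. *)
Lemma nonuniform_level_inj (R : realType) (m t : nat) (a1 a2 : R) :
  (0 < m)%N -> (1 < t)%N ->
  nonuniform_level m t a1 -> nonuniform_level m t a2 -> a1 = a2.
Proof.
move=> m0 t1; wlog le12 : a1 a2 / a1 <= a2.
  by move=> W h1 h2; have [|/ltW] := leP a1 a2 => h; [|apply/esym]; apply: W.
move=> h1 h2; have mt := nonuniform_level_lt h1.
case: h1 h2 => [ta1 am1 f1 q1] [ta2 am2 f2 q2].
apply/eqP; move: le12; rewrite le_eqVlt => /predU1P[->//|lt12].
have [|r /andP[_ r2] qr] := crit_quad_rolle m0 t1 lt12 ta1 _ f1 f2.
  exact: ltW.
have np : 0 < m.+1%:R :> R by rewrite ltr0n.
have a2n : a2 < m.+1%:R^-1 by rewrite -[_^-1]mul1r ltr_pdivlMr // mulrC.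
have [|s /andP[s2 _] qs] :=
  crit_quad_rolle m0 t1 a2n ta2 _ f2 (uniform_critical R m t).
  by rewrite mulfV ?gt_eqF.
have := crit_quad_between (crit_quad_lead R m0 mt) r2 s2.
by rewrite qr qs lexx => /(_ isT isT); rewrite ltNge q2.
Qed.

Lemma nonuniform_level_root (R : realType) (m t : nat) (a : R) :
  (0 < m)%N -> (1 < t)%N -> nonuniform_level m t a ->
  exists2 r, a < r & crit_quad m%:R t%:R r = 0.
Proof.
move=> m0 t1 [ta am f _]; have np : 0 < m.+1%:R :> R by rewrite ltr0n.
have an : a < m.+1%:R^-1 by rewrite -[_^-1]mul1r ltr_pdivlMr // mulrC.
have [|s /andP[s2 _] qs] :=
  crit_quad_rolle m0 t1 an ta _ f (uniform_critical R m t).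
  by rewrite mulfV ?gt_eqF.
by exists s.
Qed.

Lemma nonuniform_level_neq (R : realType) (m : nat) (a : R) :
  (0 < m)%N -> ~ nonuniform_level m m.+1 a.
Proof.
move=> m0 ha; have mt := nonuniform_level_lt ha.
have [r _] := nonuniform_level_root m0 (ltac:(by []) : (1 < m.+1)%N) ha.
have lead := crit_quad_lead R m0 mt.
have m1 : 1 <= m%:R :> R by rewrite ler1n.
rewrite /crit_quad -natr1; move: lead; rewrite -natr1; set x := m%:R.
set y := (x + 1 + 1) * (x * (x + 1) - 1) => lead q0.
(* Completing the square: at [t = m + 1] the discriminant is [(m + 2) (2 - 3 m)], negative for
   [m >= 1]. *)
have : (2 * y * r - (x + 1 + 1) * (x + 1 + x - 2)) ^+ 2 =
    (x + 2) * (2 - 3 * x) + 4 * y * (y * r ^+ 2 -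
      (x + 1 + 1) * (x + 1 + x - 2) * r + (x + 1 - 1)).
  by rewrite /y; ring.
rewrite q0 mulr0 addr0 => E.
have : (x + 2) * (2 - 3 * x) < 0 by rewrite pmulr_rlt0; rewrite -/x in m1; lra.
by rewrite -E ltNge sqr_ge0.
Qed.

(** The last hypothesis is [Q(1/(t-1)) < 0] with denominators cleared. If [1/(t-1) <= a], then [a]
    equals that point or lies between it and the root of [Q] beyond [a], so that [Q(a) < 0]. *)
Lemma nonuniform_level_upper (R : realType) (m t : nat) (a : R) :
  (0 < m)%N -> (1 < t)%N -> nonuniform_level m t a ->
  m%:R * (t%:R + 1) < t%:R ^+ 2 - 3 * t%:R + 4 :> R ->
  (t%:R - 1) * a < 1.
Proof.
move=> m0 t1 ha neg; have mt := nonuniform_level_lt ha.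
have [r ar qr] := nonuniform_level_root m0 t1 ha.
have [_ _ _ qa] := ha.
have t2 : 2 <= t%:R :> R by rewrite ler_nat.
have tp : 0 < t%:R - 1 :> R by lra.
rewrite mulrC -ltr_pdivlMr // ltNge; apply/negP => ca.
have qc : crit_quad m%:R t%:R (1 / (t%:R - 1)) < 0 :> R.
  rewrite -(pmulr_llt0 _ (_ : 0 < (t%:R - 1) ^+ 2)) ?exprn_gt0 //.
  have -> : crit_quad m%:R t%:R (1 / (t%:R - 1)) * (t%:R - 1) ^+ 2 =
      m%:R * (t%:R + 1) - (t%:R ^+ 2 - 3 * t%:R + 4) :> R.
    by rewrite /crit_quad; field; rewrite gt_eqF.
  by lra.
move: ca; rewrite le_eqVlt => /predU1P[ca|ca].
  by move: qa; rewrite -ca leNgt qc.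
have := crit_quad_between (crit_quad_lead R m0 mt) ca ar (ltW qc).
by rewrite qr lexx => /(_ isT); rewrite ltNge qa.
Qed.

(** * Small masses against the uniform vector *)

Lemma ln_sub_le (R : realType) (x y : R) : 0 < x -> 0 < y ->
  ln y - ln x <= (y - x) / x.
Proof.
move=> x0 y0; rewrite -ln_div ?posrE //.
have -> : y / x = 1 + (y - x) / x by field; rewrite gt_eqF.
apply: le_ln1Dx; rewrite mulrBl divff ?gt_eqF // ltrBrDr addNr.
by rewrite divr_gt0.
Qed.

Lemma is_derive_horner_ln (R : realType) (p q : {poly R}) (x : R) : 0 < q.[x] ->
  is_derive x 1 (fun y : R => p.[y] * ln q.[y])
    (p^`().[x] * ln q.[x] + p.[x] * q^`().[x] / q.[x]).
Proof.
move=> qx.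
have d1 : is_derive x 1 (@ln R \o horner q) (q.[x]^-1 * q^`().[x]).
  by apply: is_derive1_comp; exact: is_derive1_ln.
have d2 := is_deriveM (is_derive_poly p x) d1.
by apply: (is_derive_eq d2); rewrite /GRing.scale /=; ring.
Qed.

(* The logarithm of [m f(1/(t+1))] relative to the value [(1 - 1/(m+1))^t] of
   the uniform vector. *)
Definition log_gain (R : realType) (m t : R) : R :=
  t * ln (m + 1) - (t - 1) * ln m + t * ln t - (t + 1) * ln (t + 1).

Lemma mass_term_gain (R : realType) (m t : nat) : (0 < m)%N -> (0 < t)%N ->
  m%:R * mass_term t t.+1%:R^-1 =
  (1 - m.+1%:R^-1) ^+ t * expR (log_gain m%:R t%:R) :> R.
Proof.
move=> m0 t0.
have mp : 0 < m%:R :> R by rewrite ltr0n.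
have tp : 0 < t%:R :> R by rewrite ltr0n.
have np : 0 < m%:R + 1 :> R by lra.
have sp : 0 < t%:R + 1 :> R by lra.
have e1 : 1 - m.+1%:R^-1 = m%:R / (m%:R + 1) :> R.
  by rewrite -natr1; field; rewrite gt_eqF.
have e2 : 1 - t.+1%:R^-1 = t%:R / (t%:R + 1) :> R.
  by rewrite -natr1; field; rewrite gt_eqF.
rewrite /mass_term e1 e2 -natr1.
apply: ln_inj; rewrite ?posrE ?mulr_gt0 ?exprn_gt0 ?divr_gt0 ?invr_gt0 ?expR_gt0 //.
rewrite !lnM ?posrE ?mulr_gt0 ?exprn_gt0 ?divr_gt0 ?invr_gt0 ?expR_gt0 //.
rewrite expRK !lnXn ?divr_gt0 // !ln_div ?posrE // lnV ?posrE //.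
by rewrite -2!mulr_natl /log_gain; ring.
Qed.

Lemma is_derive_log_gain (R : realType) (m t : R) : 0 < m -> 0 < t ->
  is_derive t 1 (log_gain m) ((ln (m + 1) - ln m) - (ln (t + 1) - ln t)).
Proof.
move=> m0 t0.
have -> : log_gain m = horner ((ln (m + 1) - ln m) *: 'X + (ln m)%:P) +
    ((fun y : R => ('X : {poly R}).[y] * ln ('X : {poly R}).[y]) -
    (fun y : R => ('X + 1%:P : {poly R}).[y] * ln ('X + 1%:P : {poly R}).[y])).
  apply/funext => y; rewrite /log_gain !fctE !hornerE /=; ring.
have d1 := is_derive_poly ((ln (m + 1) - ln m) *: 'X + (ln m)%:P) t.
have d2 := @is_derive_horner_ln R 'X 'X t.
have d3 := @is_derive_horner_ln R ('X + 1%:P) ('X + 1%:P) t.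
rewrite !hornerE in d2 d3.
have {}d2 := d2 t0; have {}d3 := d3 (ltac:(lra)).
apply: (is_derive_eq (is_deriveD d1 (is_deriveB d2 d3))).
rewrite !poly.derivE !hornerE. rewrite /=; field; lra.
Qed.

(** The derivative in [t] is [ln (1 + 1/m) - ln (1 + 1/t)], positive once [t > m]. *)
Lemma log_gain_le (R : realType) (m t u : R) : 0 < m -> m < t -> t <= u ->
  log_gain m t <= log_gain m u.
Proof.
move=> m0 mt; rewrite le_eqVlt => /predU1P[->//|tu]; apply: ltW.
apply: (lt_of_derive_pos tu (df := fun t =>
  (ln (m + 1) - ln m) - (ln (t + 1) - ln t))) => [x|x] /andP[tx _].
  by apply: is_derive_log_gain => //; lra.
rewrite subr_gt0 -!ln_div ?posrE; try lra.
rewrite ltr_ln ?posrE ?divr_gt0 //; try lra.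
rewrite !mulrDl !divff ?gt_eqF //; try lra.
by rewrite ltrD2l !mul1r ltf_pV2 ?posrE; lra.
Qed.

Lemma ln_cross_sub_le (R : realType) (a b c d : R) :
  0 < a -> 0 < b -> 0 < c -> 0 < d ->
  (ln a - ln b) - (ln c - ln d) <= (a * d - b * c) / (b * c).
Proof.
move=> a0 b0 c0 d0; have := ln_sub_le (mulr_gt0 b0 c0) (mulr_gt0 a0 d0).
by rewrite !lnM ?posrE //; lra.
Qed.

(** At [t = m] the gain is [ln (m / (m + 1)) <= - 1 / (m + 1)]; beyond, its derivative is at most
    [(t - m) / (m (m + 1))], and this bound is integrated. *)
Lemma log_gain_upper (R : realType) (m t : R) : 0 < m -> m <= t ->
  log_gain m t <= ((t - m) ^+ 2 / (2 * m) - 1) / (m + 1).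
Proof.
move=> m0 mt.
have base : log_gain m m <= - 1 / (m + 1).
  have -> : log_gain m m = ln m - ln (m + 1) by rewrite /log_gain; ring.
  have := ln_sub_le (ltac:(lra) : 0 < m + 1) m0.
  by rewrite opprD addNKr.
pose g (x : R) := (x - m) ^+ 2 / (2 * m) / (m + 1) - log_gain m x.
have gd (x : R) : 0 < x -> is_derive x 1 g ((x - m) / (m * (m + 1)) -
    ((ln (m + 1) - ln m) - (ln (x + 1) - ln x))).
  move=> x0.
  have d1 := is_derive_poly ((2 * m * (m + 1))^-1 *: ('X - m%:P) ^+ 2) x.
  have -> : g = horner ((2 * m * (m + 1))^-1 *: ('X - m%:P) ^+ 2) - log_gain m.
    by apply/funext => y; rewrite /g !fctE !hornerE /=; field; lra.
  apply: (is_derive_eq (is_deriveB d1 (is_derive_log_gain m0 x0))).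
  rewrite !(poly.derivE, deriv_exp) !(hornerMn, hornerE) /=; field; lra.
have gm : g m <= g t.
  move: mt; rewrite le_eqVlt => /predU1P[->//|mt].
  have [x|c /andP[mc ct] gE] := mean_value mt (f := g)
    (df := fun x => (x - m) / (m * (m + 1)) -
      ((ln (m + 1) - ln m) - (ln (x + 1) - ln x))).
    by move=> /andP[mx _]; apply: gd; lra.
  rewrite -subr_ge0 gE mulr_ge0 //; last lra.
  have c0 : 0 < c by lra.
  have h := ln_cross_sub_le (ltac:(lra) : 0 < m + 1) m0
    (ltac:(lra) : 0 < c + 1) c0.
  rewrite subr_ge0; apply: le_trans h _.
  have -> : (m + 1) * c - m * (c + 1) = c - m by ring.
  apply: ler_wpM2l; first by lra.
  by rewrite lef_pV2 ?posrE ?mulr_gt0 ?ler_pM2l //; lra.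
move: gm; rewrite /g subrr expr0n /= !mul0r sub0r => gm.
have -> : ((t - m) ^+ 2 / (2 * m) - 1) / (m + 1) =
   (t - m) ^+ 2 / (2 * m) / (m + 1) + (- 1 / (m + 1)) by ring.
by lra.
Qed.

(* At [n = 2 w^2], [t = n + sqrt (2 n) = 2 w^2 + 2 w] the second order
   expansion of [log_gain] vanishes, so positivity is read off the sign of
   the derivative in [w] and the limit 0 at infinity. *)
Definition boundary_gain (R : realType) (w : R) : R :=
  log_gain (2 * w ^+ 2 - 1) (2 * w ^+ 2 + 2 * w).

Lemma boundary_gain_decr (R : realType) (v w : R) : 1 <= v -> v < w ->
  boundary_gain w < boundary_gain v.
Proof.
move=> v1 vw.
(* [N], [M], [T], [T1], [S] are [n], [m], [t], [t - 1], [t + 1] as polynomials in [w]. *)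
pose N : {poly R} := 2%:P * 'X^2.
pose M : {poly R} := N - 1%:P.
pose T : {poly R} := N + 2%:P * 'X.
pose T1 : {poly R} := T - 1%:P.
pose S : {poly R} := T + 1%:P.
have NE (y : R) : N.[y] = 2 * y ^+ 2 by rewrite /N !hornerE /=; ring.
have ME (y : R) : M.[y] = 2 * y ^+ 2 - 1 by rewrite /M /N !hornerE /=; ring.
have TE (y : R) : T.[y] = 2 * y ^+ 2 + 2 * y by rewrite /T /N !hornerE /=; ring.
have T1E (y : R) : T1.[y] = 2 * y ^+ 2 + 2 * y - 1.
  by rewrite /T1 /T /N !hornerE /=; ring.
have SE (y : R) : S.[y] = 2 * y ^+ 2 + 2 * y + 1.
  by rewrite /S /T /N !hornerE /=; ring.
have N'E (y : R) : N^`().[y] = 4 * y.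
  by rewrite /N !(poly.derivE, deriv_exp) !(hornerMn, hornerE) /=; ring.
have M'E (y : R) : M^`().[y] = 4 * y.
  by rewrite /M /N !(poly.derivE, deriv_exp) !(hornerMn, hornerE) /=; ring.
have T'E (y : R) : T^`().[y] = 4 * y + 2.
  by rewrite /T /N !(poly.derivE, deriv_exp) !(hornerMn, hornerE) /=; ring.
have T1'E (y : R) : T1^`().[y] = 4 * y + 2.
  by rewrite /T1 /T /N !(poly.derivE, deriv_exp) !(hornerMn, hornerE) /=; ring.
have S'E (y : R) : S^`().[y] = 4 * y + 2.
  by rewrite /S /T /N !(poly.derivE, deriv_exp) !(hornerMn, hornerE) /=; ring.
clearbody S T1 T M N.
(* The rational terms [4 x (T/N - T1/M)] of the derivative collapse to [- 4 / (2 x^2 - 1)]. *)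
pose dg (x : R) := (4 * x + 2) * ((ln (2 * x ^+ 2) - ln (2 * x ^+ 2 - 1)) -
   (ln (2 * x ^+ 2 + 2 * x + 1) - ln (2 * x ^+ 2 + 2 * x))) -
   4 / (2 * x ^+ 2 - 1).
apply: (gt_of_derive_neg vw (df := dg)) => x /andP[vx _].
  have x1 : 1 <= x by lra.
  have d1 := @is_derive_horner_ln R T N x.
  have d2 := @is_derive_horner_ln R T1 M x.
  have d3 := @is_derive_horner_ln R T T x.
  have d4 := @is_derive_horner_ln R S S x.
  have -> : @boundary_gain R =
    ((fun y => T.[y] * ln N.[y]) - (fun y => T1.[y] * ln M.[y])) +
    ((fun y => T.[y] * ln T.[y]) - (fun y => S.[y] * ln S.[y])).
    apply/funext => y.
    rewrite -[RHS]/((T.[y] * ln N.[y] - T1.[y] * ln M.[y]) +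
      (T.[y] * ln T.[y] - S.[y] * ln S.[y])).
    by rewrite /boundary_gain /log_gain NE ME TE T1E SE subrK; ring.
  rewrite NE in d1; rewrite ME in d2; rewrite TE in d3; rewrite SE in d4.
  have {}d1 := d1 (ltac:(nra)); have {}d2 := d2 (ltac:(nra)).
  have {}d3 := d3 (ltac:(nra)); have {}d4 := d4 (ltac:(nra)).
  apply: (is_derive_eq (is_deriveD (is_deriveB d1 d2) (is_deriveB d3 d4))).
  rewrite N'E M'E T'E T1'E S'E TE T1E ?SE /dg /=.
  field; rewrite ?gt_eqF //=; nra.
have x1 : 1 < x by lra.
have n0 : 0 < 2 * x ^+ 2 by nra.
have m0 : 0 < 2 * x ^+ 2 - 1 by nra.
have t0 : 0 < 2 * x ^+ 2 + 2 * x by nra.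
have s0 : 0 < 2 * x ^+ 2 + 2 * x + 1 by lra.
rewrite /dg subr_lt0.
have h := ln_cross_sub_le n0 m0 s0 t0.
apply: (@le_lt_trans _ _ ((4 * x + 2) * ((2 * x ^+ 2 * (2 * x ^+ 2 + 2 * x) -
   (2 * x ^+ 2 - 1) * (2 * x ^+ 2 + 2 * x + 1)) /
   ((2 * x ^+ 2 - 1) * (2 * x ^+ 2 + 2 * x + 1))))).
  by apply: ler_wpM2l => //; lra.
rewrite -subr_gt0.
have -> : 4 / (2 * x ^+ 2 - 1) - (4 * x + 2) *
   ((2 * x ^+ 2 * (2 * x ^+ 2 + 2 * x) -
   (2 * x ^+ 2 - 1) * (2 * x ^+ 2 + 2 * x + 1)) /
   ((2 * x ^+ 2 - 1) * (2 * x ^+ 2 + 2 * x + 1))) =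
   2 / ((2 * x ^+ 2 - 1) * (2 * x ^+ 2 + 2 * x + 1)).
  by field; rewrite ?gt_eqF.
by rewrite divr_gt0 // mulr_gt0.
Qed.

(** A crude bound, of which only the limit 0 matters: the two logarithms weighted by [t] contribute
    at least [1 + 1/w] and [- 1], and the remaining [ln ((t + 1) / m)] is at most [4 / w]. *)
Lemma boundary_gain_lower (R : realType) (w : R) : 1 <= w ->
  - 4 / w <= boundary_gain w.
Proof.
move=> w1.
have n0 : 0 < 2 * w ^+ 2 by nra.
have m0 : 0 < 2 * w ^+ 2 - 1 by nra.
have t0 : 0 < 2 * w ^+ 2 + 2 * w by nra.
have s0 : 0 < 2 * w ^+ 2 + 2 * w + 1 by lra.
have h1 := ln_sub_le n0 m0.
have h2 := ln_sub_le m0 s0.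
have h3 := ln_sub_le t0 s0.
rewrite /boundary_gain /log_gain subrK.
have {}h1 : 1 + 1 / w <=
    (2 * w ^+ 2 + 2 * w) * (ln (2 * w ^+ 2) - ln (2 * w ^+ 2 - 1)).
  have -> : 1 + 1 / w = (2 * w ^+ 2 + 2 * w) *
      - ((2 * w ^+ 2 - 1 - 2 * w ^+ 2) / (2 * w ^+ 2)).
    by field; lra.
  by apply: ler_wpM2l; lra.
have {}h3 : (2 * w ^+ 2 + 2 * w) *
    (ln (2 * w ^+ 2 + 2 * w + 1) - ln (2 * w ^+ 2 + 2 * w)) <= 1.
  rewrite mulrC -ler_pdivlMr //; apply: le_trans h3 _.
  by rewrite [_ + 1]addrC addrK.
have {}h2 : ln (2 * w ^+ 2 + 2 * w + 1) - ln (2 * w ^+ 2 - 1) <= 4 / w.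
  apply: le_trans h2 _.
  have -> : 2 * w ^+ 2 + 2 * w + 1 - (2 * w ^+ 2 - 1) = 2 * w + 2 by ring.
  rewrite ler_pdivrMr // mulrAC ler_pdivlMr; last lra.
  by nra.
have w0 : 0 < 1 / w by rewrite divr_gt0; lra.
rewrite mulNr; move: h1 h2 h3; lra.
Qed.

Lemma boundary_gain_gt0 (R : realType) (w : R) : 1 <= w -> 0 < boundary_gain w.
Proof.
move=> w1; rewrite ltNge; apply/negP => hw.
have h1 := boundary_gain_decr w1 (ltac:(lra) : w < w + 1).
pose d := - boundary_gain (w + 1).
have d0 : 0 < d by rewrite /d; lra.
(* Beyond [w + 1] the function stays below [- d], while [v >= 8 / d] makes the lower bound at least
   [- d / 2]. *)
pose v := Num.max (w + 2) (8 / d).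
have v1 : w + 2 <= v by rewrite le_max lexx.
have v2 : 8 / d <= v by rewrite le_max lexx orbT.
have h2 := boundary_gain_decr (ltac:(lra) : 1 <= w + 1) (ltac:(lra) : w + 1 < v).
have h3 := boundary_gain_lower (ltac:(lra) : 1 <= v).
have : 4 / v <= d / 2.
  rewrite ler_pdivrMr; last lra.
  by move: v2; rewrite ler_pdivrMr //; lra.
by move: h2 h3; rewrite mulNr -[boundary_gain (w + 1)]opprK -/d; lra.
Qed.

Lemma mass_term_le_max (R : realType) (t : nat) (x : R) : (0 < t)%N ->
  x <= 1 -> mass_term t x <= mass_term t t.+1%:R^-1.
Proof.
move=> t0 x1; have tp : 0 < t.+1%:R :> R by rewrite ltr0n.
have tc : t.+1%:R^-1 < 1 :> R by rewrite invf_lt1 // ltr1n.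
have [xc|cx|->//] := ltgtP x t.+1%:R^-1; apply: ltW.
  apply: (lt_of_derive_pos xc (fun z _ => is_derive_mass_term z t0)).
  move=> z /andP[_ zc]; rewrite mulr_gt0 ?exprn_gt0 ?subr_gt0 //.
    exact: lt_trans tc.
  by rewrite mulrC -ltr_pdivlMr // mul1r.
apply: (gt_of_derive_neg cx (fun z _ => is_derive_mass_term z t0)).
move=> z /andP[cz zx]; rewrite pmulr_rlt0 ?exprn_gt0 ?subr_gt0 //.
  by rewrite subr_lt0 mulrC -ltr_pdivrMr // mul1r.
exact: lt_le_trans x1.
Qed.

(** The witness puts the small masses at [1 / (t + 1)], the peak of [mass_term]: they alone already
    beat the uniform value by the factor [expR (log_gain m t)]. *)
Lemma two_level_beats_uniform (R : realType) (m t : nat) : (0 < m)%N ->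
  (m < t)%N -> 0 < log_gain m%:R t%:R :> R ->
  exists q : 'rV[R]_m.+1, prob_vector q /\
    expected_missing_mass t (const_mx m.+1%:R^-1 : 'rV[R]_m.+1) <
    expected_missing_mass t q.
Proof.
move=> m0 mt L0; have t0 : (0 < t)%N by apply: leq_ltn_trans mt.
have tp : 0 < t.+1%:R :> R by rewrite ltr0n.
have mlt : m%:R * t.+1%:R^-1 < 1 :> R.
  by rewrite ltr_pdivrMr // mul1r ltr_nat ltnS ltnW.
have mp : 0 < m%:R * t.+1%:R^-1 :> R by rewrite divr_gt0 // ltr0n.
exists (two_level m t.+1%:R^-1); split.
  by apply: prob_vector_two_level; rewrite ?invr_ge0 ?ltW.
rewrite expected_missing_mass_const //.
rewrite expected_missing_mass_two_level ?invr_ge0 ?(ltW mlt) //.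
rewrite /two_level_mass mass_term_gain //.
have n1 : 0 < 1 - m.+1%:R^-1 :> R.
  by rewrite subr_gt0 invf_lt1 ?ltr0n // ltr1n.
apply: (@le_lt_trans _ _ ((1 - m.+1%:R^-1) ^+ t * expR (log_gain m%:R t%:R))).
  by rewrite ler_peMr ?exprn_ge0 ?ltW // expR_gt1.
rewrite ltrDl /mass_term mulr_gt0 ?exprn_gt0 ?subr_gt0 //.
by rewrite ltrBlDr ltrDl.
Qed.

Lemma sqrt_double (R : realType) (x : R) : 0 <= x ->
  Num.sqrt (2 * x) = 2 * Num.sqrt (x / 2).
Proof.
move=> x0; have x2 : 0 <= x / 2 by lra.
have {1}-> : 2 * x = 2 ^+ 2 * (x / 2) by field.
by rewrite sqrtrM ?exprn_ge0 // sqrtr_sqr normr_nat.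
Qed.

Lemma log_gain_gt0 (R : realType) (m t : nat) : (0 < m)%N ->
  m.+1%:R + Num.sqrt (2 * m.+1%:R) <= t%:R :> R -> 0 < log_gain m%:R t%:R :> R.
Proof.
move=> m0 nt; have n2 : 2 <= m.+1%:R :> R by rewrite ler_nat.
(* With this [w], [n = 2 w^2] and [sqrt (2 n) = 2 w], the parametrization of [boundary_gain]. *)
pose w : R := Num.sqrt (m.+1%:R / 2).
have w2 : w ^+ 2 = m.+1%:R / 2 by rewrite sqr_sqrtr // divr_ge0.
have w0 : 0 <= w by exact: sqrtr_ge0.
have w1 : 1 <= w by nra.
have sE : Num.sqrt (2 * m.+1%:R) = 2 * w by apply: sqrt_double.
have := boundary_gain_gt0 w1; rewrite /boundary_gain.
have nE : m.+1%:R = 2 * w ^+ 2 by rewrite w2; field.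
have -> : 2 * w ^+ 2 - 1 = m%:R by rewrite -nE -natr1 addrK.
move=> /lt_le_trans; apply; apply: log_gain_le; rewrite ?ltr0n //.
  by move: nE; rewrite -natr1; lra.
by rewrite -nE -sE.
Qed.

(** * Comparison of consecutive sample sizes *)

(** Induction by [step]: each expression is [y] times the previous one plus
    [(y - c) (y^(k+1) - c^(k+1)) >= 0]. The strict part is shifted by one because the expression
    vanishes identically at [t = 0]. *)
Lemma power_tangent_ge0 (R : realType) (t : nat) (c y : R) : 0 < c -> 0 <= y ->
  0 <= t%:R * y ^+ t.+1 + c ^+ t.+1 - t.+1%:R * (c * y ^+ t) /\
  (y != c -> 0 < t.+1%:R * y ^+ t.+2 + c ^+ t.+2 - t.+2%:R * (c * y ^+ t.+1)).
Proof.
move=> c0 y0.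
have step k : k.+1%:R * y ^+ k.+2 + c ^+ k.+2 - k.+2%:R * (c * y ^+ k.+1) =
    y * (k%:R * y ^+ k.+1 + c ^+ k.+1 - k.+1%:R * (c * y ^+ k)) +
    (y - c) * (y ^+ k.+1 - c ^+ k.+1).
  by rewrite !exprS -!natr1; ring.
have pos k : y != c -> 0 < (y - c) * (y ^+ k.+1 - c ^+ k.+1).
  rewrite neq_lt => /orP[yc|cy].
    by rewrite nmulr_rgt0 ?subr_lt0 // ltrXn2r.
  by rewrite mulr_gt0 ?subr_gt0 // ltrXn2r // ltW.
have ge0 k : 0 <= k%:R * y ^+ k.+1 + c ^+ k.+1 - k.+1%:R * (c * y ^+ k).
  elim: k => [|k IH]; first by rewrite mul0r add0r !expr1 !mulr1 mul1r subrr.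
  rewrite step; apply: addr_ge0; first exact: mulr_ge0.
  by have [->|/(pos k)/ltW //] := eqVneq y c; rewrite subrr mul0r.
split=> // yc; rewrite step ltr_wpDl ?pos // mulr_ge0 //.
Qed.

Lemma prob_vector_neq_const (R : realType) (n : nat) (q : 'rV[R]_n) :
  (0 < n)%N -> prob_vector q -> q <> const_mx n%:R^-1 ->
  exists i, n%:R^-1 < q ord0 i.
Proof.
move=> n0 [q0 q1] qu; apply: contrapT => nex; apply: qu.
have qle i : q ord0 i <= n%:R^-1.
  by rewrite leNgt; apply/negP => h; apply: nex; exists i.
have : \sum_(i < n) (n%:R^-1 - q ord0 i) = 0.
  rewrite sumrB q1 sumr_const card_ord -[X in X - _]mulr_natr mulVf ?subrr //.
  by rewrite pnatr_eq0 -lt0n.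
move=> /eqP; rewrite psumr_eq0 => [/allP qn|i _]; last by rewrite subr_ge0.
apply/rowP => i; rewrite mxE; apply/esym/eqP; rewrite -subr_eq0.
exact: qn (mem_index_enum _).
Qed.

(** With [c = 1 - 1/n] and [y = 1 - q_k], averaging [power_tangent_ge0] with weights [q_k] gives [t
    E_(t+1) + c^(t+1) > (t+1) c E_t >= (t+1) c^(t+1)], where [E_t] is the value at [q]. Strictness
    comes from a coordinate above [1/n]. *)
Lemma uniform_beaten_succ (R : realType) (n t : nat) (q : 'rV[R]_n) :
  (1 < n)%N -> (0 < t)%N -> prob_vector q -> q <> const_mx n%:R^-1 ->
  expected_missing_mass t (const_mx n%:R^-1 : 'rV[R]_n) <=
    expected_missing_mass t q ->
  expected_missing_mass t.+1 (const_mx n%:R^-1 : 'rV[R]_n) <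
    expected_missing_mass t.+1 q.
Proof.
move=> n1 t0 qq qu; have n0 : (0 < n)%N by apply: ltn_trans n1.
have [i qi] := prob_vector_neq_const n0 qq qu.
rewrite !expected_missing_mass_const // !expected_missing_massE //.
set c : R := 1 - n%:R^-1.
have c0 : 0 < c by rewrite subr_gt0 invf_lt1 ?ltr0n // ltr1n.
have nv : 0 < n%:R^-1 :> R by rewrite invr_gt0 ltr0n.
have q1 k : 0 <= 1 - q ord0 k.
  by rewrite subr_ge0 -qq.2 (bigD1 k) //= lerDl sumr_ge0 // => l _; apply: qq.1.
case: t t0 => // t _ h.
have pos : 0 < \sum_(k < n) q ord0 k * (t.+1%:R * (1 - q ord0 k) ^+ t.+2 +
    c ^+ t.+2 - t.+2%:R * (c * (1 - q ord0 k) ^+ t.+1)).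
  rewrite (bigD1 i) //= ltr_pwDl //.
    apply: mulr_gt0; first exact: lt_trans qi.
    apply: (power_tangent_ge0 t c0 (q1 i)).2.
    by rewrite lt_eqF // /c ltrD2l ltrN2.
  apply: sumr_ge0 => k _; rewrite mulr_ge0 ?qq.1 //.
  exact: (power_tangent_ge0 t.+1 c0 (q1 k)).1.
have E : \sum_(k < n) q ord0 k * (t.+1%:R * (1 - q ord0 k) ^+ t.+2 +
    c ^+ t.+2 - t.+2%:R * (c * (1 - q ord0 k) ^+ t.+1)) =
  t.+1%:R * (\sum_(k < n) q ord0 k * (1 - q ord0 k) ^+ t.+2) + c ^+ t.+2 -
  t.+2%:R * (c * \sum_(k < n) q ord0 k * (1 - q ord0 k) ^+ t.+1).
  rewrite -[X in _ + X - _]mul1r -qq.2 mulr_suml !mulr_sumr -big_split -sumrB /=.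
  by apply: eq_bigr => k _; ring.
have tp : 0 < t.+1%:R :> R by rewrite ltr0n.
rewrite -(ltr_pM2l tp); move: pos; rewrite E.
have : t.+2%:R * (c * c ^+ t.+1) <=
  t.+2%:R * (c * \sum_(k < n) q ord0 k * (1 - q ord0 k) ^+ t.+1).
  by rewrite ler_pM2l ?ltr0n // ler_pM2l.
rewrite -exprS -[t.+2%:R in X in X -> _]natr1 mulrDl mul1r.
by lra.
Qed.

(** * Estimates just below [n + sqrt (2 n)] *)

(** The term is at most [(m a)^t <= exp (- t (1 - m a))], and [a < 1/(t-1)] gives
    [t m a <= m + m a < m + 1]. *)
Lemma nonuniform_level_tail (R : realType) (m t : nat) (a : R) :
  (0 < m)%N -> (1 < t)%N -> nonuniform_level m t a ->
  m%:R * (t%:R + 1) < t%:R ^+ 2 - 3 * t%:R + 4 :> R ->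
  mass_term t (1 - m%:R * a) <= expR (- (t%:R - 1 - m%:R)).
Proof.
move=> m0 t1 ha neg; have ta := nonuniform_level_upper m0 t1 ha neg.
have [ta1 am _ _] := ha.
have mp : 0 < m%:R :> R by rewrite ltr0n.
have a0 : 0 < a by rewrite -(pmulr_rgt0 _ (_ : 0 < t.+1%:R)) ?ltr0n //; lra.
have ma := mulr_gt0 mp a0.
have t2 : 2 <= t%:R :> R by rewrite ler_nat.
have ma1 : m%:R * a < 1 by move: am; rewrite -natr1; lra.
have -> : mass_term t (1 - m%:R * a) = (1 - m%:R * a) * (m%:R * a) ^+ t.
  by rewrite /mass_term; congr (_ * _ ^+ t); ring.
apply: (@le_trans _ _ ((m%:R * a) ^+ t)).
  by rewrite ler_piMl ?exprn_ge0 //; lra.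
apply: (@le_trans _ _ (expR (- (1 - m%:R * a)) ^+ t)).
  rewrite lerXn2r ?nnegrE ?expR_ge0 ?(ltW ma) //.
  by have := expR_ge1Dx (- (1 - m%:R * a)); lra.
rewrite -expRM_natl ler_expR.
have : m%:R * ((t%:R - 1) * a) <= m%:R by rewrite ger_pMr // ltW.
nra.
Qed.

(** The fourth order Taylor term gives [exp (s - 7) > (s/2)^4 / 24 = s^4 / 384], whence the constant
    384. *)
Lemma expR_lt_inv_cube (R : realType) (s : R) : 384 < s ->
  expR (- (s - 5)) < expR (- 2) * (s ^+ 3)^-1.
Proof.
move=> s0.
have s3 : 0 < s ^+ 3 by rewrite exprn_gt0; lra.
have : s ^+ 3 < expR (s - 7).
  have := @expR_ge1Dxn R (s - 7) 3 (ltac:(lra)).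
  have -> : 4`!%:R = 24 :> R by [].
  have : (s / 2) ^+ 4 <= (s - 7) ^+ 4 by rewrite lerXn2r ?nnegrE; lra.
  have -> : (s / 2) ^+ 4 = s * s ^+ 3 / 16 by field.
  have : 384 * s ^+ 3 < s * s ^+ 3 by rewrite ltr_pM2r.
  by lra.
rewrite ltr_pdivlMr //.
have -> : expR (- 2) = expR (- (s - 5)) * expR (s - 7) :> R.
  by rewrite -expRD; congr expR; ring.
by rewrite ltr_pM2l ?expR_gt0.
Qed.

(* Just below [n + sqrt (2 n)] the many small masses lose a factor
   [1 - O(n^(-3/2))] against the uniform vector, while the large one
   contributes only [exp (- sqrt (2 n) + O(1))]. *)
Lemma two_level_mass_lt_uniform (R : realType) (m t : nat) (a : R) :
  (0 < m)%N -> (1 < t)%N -> nonuniform_level m t a ->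
  let s := Num.sqrt (2 * m.+1%:R) : R in
  384 < s -> s - 4 <= t%:R - m%:R -> t%:R - m%:R <= s - 3 ->
  two_level_mass m t a < (1 - m.+1%:R^-1) ^+ t.
Proof.
move=> m0 t1 ha s s0 lo hi.
have mp : 0 < m%:R :> R by rewrite ltr0n.
have t0 : (0 < t)%N by apply: ltn_trans t1.
have s2 : s ^+ 2 = 2 * (m%:R + 1) by rewrite sqr_sqrtr ?natr1 // mulr_ge0.
have tail : mass_term t (1 - m%:R * a) <= expR (- (s - 5)).
  apply: le_trans (nonuniform_level_tail m0 t1 ha _) _; last first.
    by rewrite ler_expR; lra.
  by nra.
have [ta1 am _ _] := ha.
have a1 : a <= 1.
  have a0 : 0 < a by rewrite -(pmulr_rgt0 _ (_ : 0 < t.+1%:R)) ?ltr0n //; lra.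
  have := mulr_gt0 mp a0; move: am; rewrite -natr1; lra.
have small : m%:R * mass_term t a <=
    (1 - m.+1%:R^-1) ^+ t * expR (log_gain m%:R t%:R).
  by rewrite -mass_term_gain // ler_pM2l // mass_term_le_max.
set U := (1 - m.+1%:R^-1) ^+ t in small *.
have s3 : 0 < s ^+ 3 by rewrite exprn_gt0; lra.
have L : log_gain m%:R t%:R <= - (2 / s ^+ 3).
  apply: le_trans (log_gain_upper mp (ltac:(lra) : m%:R <= t%:R)) _.
  have nE : m%:R + 1 = s ^+ 2 / 2 by rewrite s2; field.
  rewrite nE.
  (* The margin 3 in [t - m <= s - 3] gives [(s - 3)^2 <= (1 - 1/s) (s^2 - 2)], where
     [s^2 - 2 = 2 m]. *)
  have d2 : (t%:R - m%:R) ^+ 2 / (2 * m%:R) <= 1 - 1 / s.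
    rewrite ler_pdivrMr; last lra.
    have : (t%:R - m%:R) ^+ 2 <= (s - 3) ^+ 2 by rewrite lerXn2r ?nnegrE; lra.
    move=> /le_trans; apply.
    have -> : 2 * m%:R = s ^+ 2 - 2 by rewrite s2; ring.
    have -> : (1 - 1 / s) * (s ^+ 2 - 2) = s ^+ 2 - 2 - s + 2 / s by field; lra.
    have : 0 < 2 / s by rewrite divr_gt0; lra.
    nra.
  have -> : - (2 / s ^+ 3) = (1 - 1 / s - 1) / (s ^+ 2 / 2) by field; lra.
  rewrite ler_pM2r; first by lra.
  by rewrite invr_gt0 -nE; lra.
(* [U >= exp (- t / m)], and [t <= 2 m] in this range. *)
have Ulo : expR (- 2) <= U.
  have -> : U = expR (- (t%:R * (ln (m%:R + 1) - ln m%:R))).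
    rewrite -mulrN expRM_natl opprB expRB !lnK ?posrE; try lra.
    by rewrite /U -natr1; congr (_ ^+ _); field; lra.
  rewrite ler_expR lerN2.
  have h : ln (m%:R + 1) - ln m%:R <= 1 / m%:R :> R.
    have := ln_sub_le mp (ltac:(lra) : 0 < m%:R + 1).
    by rewrite [m%:R + 1 - _]addrAC subrr add0r.
  apply: (@le_trans _ _ (t%:R * (1 / m%:R))); first by rewrite ler_wpM2l.
  by rewrite mulrA mulr1 ler_pdivrMr //; nra.
have Up : 0 < U by apply: lt_le_trans Ulo; exact: expR_gt0.
(* For [x = s^(-3) < 1/2], [exp (- 2 x) <= 1 / (1 + 2 x) <= 1 - x]; the loss [U x >= exp (- 2) x]
   then exceeds the tail. *)
have eL : expR (log_gain m%:R t%:R) <= 1 - (s ^+ 3)^-1.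
  have : expR (log_gain m%:R t%:R) <= expR (- (2 / s ^+ 3)) by rewrite ler_expR.
  move=> /le_trans; apply.
  have x1 : (s ^+ 3)^-1 < 1 / 2.
    rewrite -[_^-1]mul1r ltr_pdivrMr //.
    have : 0 <= s * (s ^+ 2) by rewrite mulr_ge0 ?sqr_ge0; lra.
    by rewrite -exprS; nra.
  have x0 : 0 < (s ^+ 3)^-1 by rewrite invr_gt0.
  set x := (s ^+ 3)^-1 in x0 x1 *.
  rewrite expRN -[X in _ <= X]invrK.
  rewrite lef_pV2 ?posrE ?expR_gt0 ?invr_gt0 //; last lra.
  apply: le_trans (expR_ge1Dx _).
  rewrite -[_^-1]mul1r ler_pdivrMr; last lra.
  by nra.
have := expR_lt_inv_cube s0 => fin.
have : expR (- 2) * (s ^+ 3)^-1 <= U * (s ^+ 3)^-1.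
  by rewrite ler_pM2r ?invr_gt0.
have : U * expR (log_gain m%:R t%:R) <= U * (1 - (s ^+ 3)^-1).
  by rewrite ler_pM2l.
rewrite /two_level_mass mulrBr mulr1; lra.
Qed.

(** * The threshold *)

(** Its negation is what makes the uniform vector the unique maximum, whereas uniqueness of a
    nonuniform maximum is derived from [uniform_beaten]. *)
Definition uniform_tied (R : realType) (n t : nat) : Prop :=
  exists q : 'rV[R]_n, [/\ prob_vector q, q <> const_mx n%:R^-1 &
    expected_missing_mass t (const_mx n%:R^-1 : 'rV[R]_n) <=
    expected_missing_mass t q].

Definition uniform_beaten (R : realType) (n t : nat) : Prop :=
  exists q : 'rV[R]_n, prob_vector q /\
    expected_missing_mass t (const_mx n%:R^-1 : 'rV[R]_n) <
    expected_missing_mass t q.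

Lemma uniform_beaten_tied (R : realType) (n t : nat) :
  uniform_beaten R n t -> uniform_tied R n t.
Proof.
move=> [q [qq lt]]; exists q; split; rewrite ?ltW // => e.
by rewrite e ltxx in lt.
Qed.

Lemma uniform_tied_lt (R : realType) (n t u : nat) : (1 < n)%N -> (0 < t)%N ->
  (t < u)%N -> uniform_tied R n t -> uniform_beaten R n u.
Proof.
move=> n1 t0 tu [q [qq qu h]].
have {h} : forall k,
    expected_missing_mass (t + k) (const_mx n%:R^-1 : 'rV[R]_n) <=
    expected_missing_mass (t + k) q.
  elim=> [|k IH]; rewrite ?addn0 // addnS ltW //.
  by apply: uniform_beaten_succ => //; rewrite addn_gt0 t0.
move=> /(_ (u - t.+1)%N) h; exists q; split=> //.
have -> : u = (t + (u - t.+1)).+1 by lia.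
by apply: uniform_beaten_succ => //; rewrite addn_gt0 t0.
Qed.

Lemma uniform_unique (R : realType) (n t : nat) : (0 < n)%N ->
  ~ uniform_tied R n t ->
  unique_global_maximum t (const_mx n%:R^-1 : 'rV[R]_n).
Proof.
move=> n0 ntied; have uu := prob_vector_const R n0.
have uord : ordered_prob_vector (const_mx n%:R^-1 : 'rV[R]_n).
  by split=> // i j _; rewrite !mxE.
split=> //.
  split=> // q qq; have [->//|/eqP qu] := eqVneq q (const_mx n%:R^-1).
  by rewrite leNgt; apply/negP => /ltW h; apply: ntied; exists q.
move=> q [qq _] [_ qmax]; apply: contrapT => qu; apply: ntied.
by exists q; split=> //; exact: qmax.
Qed.

(** If the maximizer given by compactness is uniform, the tied competitor is itself a maximizer. *)
Lemma uniform_tied_maximum (R : realType) (n t : nat) : (0 < n)%N ->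
  uniform_tied R n t -> exists p : 'rV[R]_n,
    [/\ ordered_prob_vector p, global_maximum t p & p <> const_mx n%:R^-1].
Proof.
move=> n0 [q [qq qu h]].
suff [r rmax ru] : exists2 r : 'rV[R]_n,
    global_maximum t r & r <> const_mx n%:R^-1.
  have [p [pord pmax pc]] := sorted_global_maximum rmax.
  by exists p; split=> // /pc.
have [r rmax] := exists_global_maximum R t n0.
have [ru|/eqP ru] := eqVneq r (const_mx n%:R^-1); last by exists r.
exists q => //; split=> // v vv; apply: le_trans h; rewrite -ru.
exact: rmax.2.
Qed.

Lemma not_uniform_tied_diag (R : realType) (m : nat) : (0 < m)%N ->
  ~ uniform_tied R m.+1 m.+1.
Proof.
move=> m0 /(uniform_tied_maximum (ltn0Sn m))[p [pord pmax pu]].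
by have [_ /(nonuniform_level_neq m0)] :=
  nonuniform_maximum m0 (m0 : (1 < m.+1)%N) pord pmax pu.
Qed.

Lemma uniform_beaten_unique (R : realType) (m t : nat) : (0 < m)%N ->
  (1 < t)%N -> uniform_beaten R m.+1 t ->
  exists p : 'rV[R]_m.+1, [/\ unique_global_maximum t p,
    all_but_last_equal p & last_strictly_dominates p].
Proof.
move=> m0 t1 ht.
have nu (q : 'rV[R]_m.+1) : global_maximum t q -> q <> const_mx m.+1%:R^-1.
  move=> [_ qmax] qu; case: ht => v [vv].
  by rewrite -qu ltNge qmax.
have [p [pord pmax pu]] :=
  uniform_tied_maximum (ltn0Sn m) (uniform_beaten_tied ht).
have [pE pl] := nonuniform_maximum m0 t1 pord pmax pu.
exists p; split.
- split=> // q qord qmax.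
  have [qE ql] := nonuniform_maximum m0 t1 qord qmax (nu _ qmax).
  by rewrite qE pE (nonuniform_level_inj m0 t1 ql pl).
- by move=> i j im jm; rewrite pE !mxE im jm.
move=> i k im km; rewrite pE !mxE im km ltnn.
by case: pl => _ + _ _; rewrite -natr1; lra.
Qed.

Lemma uniform_beaten_large (R : realType) (m t : nat) : (0 < m)%N ->
  m.+1%:R + Num.sqrt (2 * m.+1%:R) <= t%:R :> R -> uniform_beaten R m.+1 t.
Proof.
move=> m0 h; apply: two_level_beats_uniform => //; last exact: log_gain_gt0.
rewrite -(ltr_nat R); apply: lt_le_trans h.
by rewrite ltr_wpDr ?sqrtr_ge0 // ltr_nat.
Qed.

Lemma not_uniform_tied_below (R : realType) (m t : nat) : (0 < m)%N ->
  let s := Num.sqrt (2 * m.+1%:R) : R in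
  384 < s -> s - 4 <= t%:R - m%:R -> t%:R - m%:R <= s - 3 ->
  ~ uniform_tied R m.+1 t.
Proof.
move=> m0 s s0 lo hi; have t1 : (1 < t)%N.
  by rewrite -(ltr_nat R); have : 0 <= m%:R :> R by []; lra.
move=> /(uniform_tied_maximum (ltn0Sn m))[p [pord pmax pu]].
have [pE pl] := nonuniform_maximum m0 t1 pord pmax pu.
have := two_level_mass_lt_uniform m0 t1 pl s0 lo hi.
have [_ am _ _] := pl; have a0 := pord.1.1 ord0.
rewrite -expected_missing_mass_two_level // -?pE; last first.
  by move: am a0; rewrite -natr1; lra.
rewrite -(@expected_missing_mass_const R m.+1) // ltNge.
by rewrite pmax.2 //; exact: prob_vector_const.
Qed.

(** The threshold is the least [t] with a tie, or half a unit less. Positivity of [n] stands inside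
    the existential so that choice yields a total function, and an error of 5 is negligible against
    [sqrt (2 n)]. *)
Lemma threshold_exists (R : realType) (n : nat) : exists x : R, (0 < n)%N ->
  [/\ n%:R < x,
    forall t, (1 <= t)%N -> t%:R < x ->
      unique_global_maximum t (const_mx n%:R^-1 : 'rV[R]_n),
    forall t, (1 <= t)%N -> x < t%:R ->
      exists p : 'rV[R]_n, [/\ unique_global_maximum t p,
        all_but_last_equal p & last_strictly_dominates p] &
    384 < Num.sqrt (2 * n%:R) :> R ->
      `|x - n%:R - Num.sqrt (2 * n%:R)| <= 5].
Proof.
case: n => [|[|m']]; first by exists 0.
  (* For [n = 1] there is a single probability vector, so any real above 1 would do; the last clause
     is vacuous. *)
  exists 2 => _.
  have single (q : 'rV[R]_1) : prob_vector q -> q = const_mx 1%:R^-1.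
    move=> [_]; rewrite big_ord1 => q1; apply/rowP => i.
    by rewrite (ord1 i) mxE q1 invr1.
  have uni t : unique_global_maximum t (const_mx 1%:R^-1 : 'rV[R]_1).
    by apply: uniform_unique => // -[q [/single]].
  split=> [|t _ _|t _ _|h]; first by rewrite ltr1n.
  - exact: uni.
  - by exists (const_mx 1%:R^-1); split=> // i.
  - have := sqrtr_ge0 (2 * 1%:R : R).
    have := @sqr_sqrtr R (2 * 1%:R) (ltac:(lra)).
    nra.
set m := m'.+1; have m0 : (0 < m)%N by [].
set s : R := Num.sqrt (2 * m.+1%:R); have s0 : 0 <= s by exact: sqrtr_ge0.
have /andP[ks sk] := truncn_itv s0; set k := Num.truncn s in ks sk.
rewrite -natr1 in sk.
have large : uniform_beaten R m.+1 (m.+1 + k + 1).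
  apply: uniform_beaten_large => //; rewrite -/s !natrD; lra.
have exP : exists t, (0 < t)%N && `[< uniform_tied R m.+1 t >].
  exists (m.+1 + k + 1)%N; apply/andP; split; first by lia.
  by apply/asboolP/uniform_beaten_tied.
case: (ex_minnP exP) => t0 /andP[t00 /asboolP tied0] tmin.
have lt_t0 t : (0 < t)%N -> ~ uniform_tied R m.+1 t -> (t < t0)%N.
  move=> tp nt; rewrite ltnNge leq_eqVlt; apply/negP => /predU1P[e|lt].
    by apply: nt; rewrite -e.
  by apply/nt/uniform_beaten_tied/(uniform_tied_lt _ _ lt tied0).
have below t : (0 < t)%N -> (t < t0)%N -> ~ uniform_tied R m.+1 t.
  move=> tp lt tt; have := tmin t; rewrite tp /= leqNgt lt => /(_ _)/negP; apply.
    by apply/asboolP.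
  by [].
have nt0 : (m.+1 < t0)%N by apply: lt_t0 => //; exact: not_uniform_tied_diag.
have above t : (t0 < t)%N -> uniform_beaten R m.+1 t.
  by move=> lt; exact: uniform_tied_lt lt tied0.
have t0le : (t0 <= m.+1 + k + 1)%N.
  apply: tmin; apply/andP; split; first by lia.
  by apply/asboolP/uniform_beaten_tied.
have lower : 384 < s -> (m.+1 + k - 4 < t0)%N.
  move=> s3; have k4 : (4 <= k)%N by rewrite -(ler_nat R); lra.
  have e : (m.+1 + k - 4)%:R = m%:R + 1 + k%:R - 4 :> R.
    (* Thus [t - m = k - 3], and [s - 1 < k <= s] places it in the window from [s - 4] to
       [s - 3]. *)
    by rewrite natrB ?natrD -?natr1 //; lia.
  apply: lt_t0; first lia.
  by apply: not_uniform_tied_below => //; rewrite -/s e; lra.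
have t0leR : t0%:R <= m%:R + 1 + k%:R + 1 :> R.
  have : t0%:R <= (m.+1 + k + 1)%:R :> R by rewrite ler_nat.
  by rewrite !natrD -natr1.
have lowerR : 384 < s -> m%:R + 1 + k%:R + 1 <= t0%:R + 4 :> R.
  move=> /lower h.
  have : (m.+1 + k + 1)%:R <= (t0 + 4)%:R :> R by rewrite ler_nat; lia.
  by rewrite !natrD -natr1.
have nt0R : m%:R + 1 + 1 <= t0%:R :> R by rewrite !natr1 ler_nat.
(* Shared by both choices of threshold. For large [s], [t0] is between [n + s - 4] and [n + s + 1],
   so with the half unit the error stays below 5. *)
have fin x : x <= t0%:R -> t0%:R - 1 / 2 <= x ->
    (forall t, x < t%:R -> uniform_beaten R m.+1 t) ->
  [/\ m.+1%:R < x,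
    forall t, (1 <= t)%N -> t%:R < x ->
      unique_global_maximum t (const_mx m.+1%:R^-1 : 'rV[R]_m.+1),
    forall t, (1 <= t)%N -> x < t%:R ->
      exists p : 'rV[R]_m.+1, [/\ unique_global_maximum t p,
        all_but_last_equal p & last_strictly_dominates p] &
    384 < s -> `|x - m.+1%:R - s| <= 5].
  move=> xle xge hx; split=> [|t tp tx|t tp tx|s3].
  - by rewrite -natr1; lra.
  - apply: uniform_unique => //; apply: below => //.
    by rewrite -(ltr_nat R); exact: lt_le_trans xle.
  - apply: uniform_beaten_unique => //; last exact: hx.
    rewrite -(ltr_nat R); have : 0 <= m%:R :> R by []; lra.
  - have := lowerR s3; rewrite ler_norml -natr1; lra.
(* At the least [t0] where the uniform vector is tied it may be strictly beaten
   already, and the threshold must then be smaller than [t0]. *)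
have [strict|nstrict] := pselect (uniform_beaten R m.+1 t0).
  exists (t0%:R - 1 / 2) => _; apply: fin; [lra|lra|move=> t tx].
  have : (t0 <= t)%N.
    rewrite leqNgt -ltnS; apply/negP; rewrite ltnS -(ler_nat R) -natr1; lra.
  by rewrite leq_eqVlt => /predU1P[<-//|]; exact: above.
exists t0%:R => _; apply: fin; [lra|lra|move=> t].
by rewrite ltr_nat; exact: above.
Qed.

(** * Bounds on the small masses *)

(** The critical equation reads [(t+1) a - 1 = r^(t-1) (t - (t+1) m a)] with [r = m a / (1 - a)], so
    [a] exceeds [1/(t+1)] by less than [r^(t-1)]. Since [a < 1/(t-1)], [r <= m / (t - 2)], and
    [r^(t-1) <= exp (- (t - 2 - m)) <= exp (- w)]. *)
Lemma nonuniform_level_bounds (R : realType) (m t : nat) (a : R) : (0 < m)%N ->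
  m.+1%:R + Num.sqrt (2 * m.+1%:R) <= t%:R :> R -> nonuniform_level m t a ->
  (t%:R + 1)^-1 < a /\
  a < (t%:R + 1)^-1 + expR (- Num.sqrt (m.+1%:R / 2)).
Proof.
move=> m0 nt ha; have n2 : 2 <= m.+1%:R :> R by rewrite ler_nat.
pose w : R := Num.sqrt (m.+1%:R / 2); rewrite -/w.
have w2 : w ^+ 2 = m.+1%:R / 2 by rewrite sqr_sqrtr // divr_ge0.
have w0 : 0 <= w by exact: sqrtr_ge0.
have w1 : 1 <= w by nra.
have sE : Num.sqrt (2 * m.+1%:R) = 2 * w by apply: sqrt_double.
have mp : 1 <= m%:R :> R by rewrite ler1n.
rewrite sE -natr1 in nt.
have tR : 4 <= t%:R :> R by lra.
have t4 : (4 <= t)%N by rewrite -(ler_nat R).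
have t1 : (1 < t)%N by apply: leq_trans t4.
have neg : m%:R * (t%:R + 1) < t%:R ^+ 2 - 3 * t%:R + 4 :> R.
  have mE : m%:R = 2 * w ^+ 2 - 1 by rewrite w2 -natr1; field.
  rewrite mE in nt *; set T := 2 * w ^+ 2 + 2 * w.
  have tT : T <= t%:R by rewrite /T; lra.
  (* The inequality is checked at the smallest admissible value [T]; the difference at [t] and [T]
     factors through [t - T]. *)
  have T0 : 0 < T ^+ 2 - 3 * T + 4 - (2 * w ^+ 2 - 1) * (T + 1).
    by rewrite /T; have := mulr_ge0 w0 (sqr_ge0 (w - 1)); nra.
  have : 0 <= (t%:R - T) * (t%:R + T - 3 - (2 * w ^+ 2 - 1)).
    by rewrite mulr_ge0 //; rewrite /T in tT *; nra.
  by lra.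
have ta := nonuniform_level_upper m0 t1 ha neg.
have [ta1 am fo _] := ha.
have tp : 0 < t%:R + 1 :> R by lra.
rewrite -natr1 in ta1.
have lo : (t%:R + 1)^-1 < a by rewrite -[_^-1]mul1r ltr_pdivrMr // mulrC.
split=> //; have a0 : 0 < a by apply: lt_trans lo; rewrite invr_gt0.
have ma : 0 < m%:R * a by rewrite mulr_gt0 //; lra.
have a1 : a < 1 by move: am; rewrite -natr1; lra.
pose r := m%:R * a / (1 - a).
have r0 : 0 < r by rewrite divr_gt0 // subr_gt0.
have key : (t%:R + 1) * a - 1 = r ^+ t.-1 * (t%:R - (t%:R + 1) * (m%:R * a)).
  have a1k : (1 - a) ^+ t.-1 != 0 by rewrite expf_neq0 // subr_eq0 gt_eqF.
  apply: (mulfI a1k); rewrite [RHS]mulrA -exprMn /r [_ * (_ / _)]mulrC.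
  rewrite divfK ?subr_eq0 ?gt_eqF //.
  move: fo; rewrite /mass_term1 -natr1.
  have -> : 1 - (1 - m%:R * a) = m%:R * a by ring.
  move=> fo; transitivity (- ((1 - a) ^+ t.-1 * (1 - (t%:R + 1) * a))).
    by ring.
  by rewrite fo; ring.
pose x : R := (t%:R - 2 - m%:R) / (t%:R - 2).
have rx : r <= expR (- x).
  apply: le_trans (expR_ge1Dx _).
  have -> : 1 + - x = m%:R / (t%:R - 2) by rewrite /x; field; lra.
  rewrite /r -mulrA ler_pM2l; last lra.
  rewrite ler_pdivrMr; last lra.
  by rewrite mulrC ler_pdivlMr; lra.
have rw : r ^+ t.-1 <= expR (- w).
  apply: (@le_trans _ _ (expR (- x) ^+ t.-1)).
    by rewrite lerXn2r ?nnegrE ?expR_ge0 ?(ltW r0).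
  rewrite -expRM_natl ler_expR mulrN lerN2.
  have -> : t.-1%:R = t%:R - 1 :> R by rewrite -subn1 natrB // ltnW.
  apply: (@le_trans _ _ (t%:R - 2 - m%:R)); first lra.
  rewrite /x mulrA ler_pdivlMr; last lra.
  by rewrite mulrC ler_wpM2r; lra.
have rk : 0 < r ^+ t.-1 by rewrite exprn_gt0.
rewrite -(ltr_pM2l tp) mulrDr mulfV ?gt_eqF // -ltrBlDl key.
apply: (@lt_le_trans _ _ (r ^+ t.-1 * (t%:R + 1))).
  rewrite ltr_pM2l //; have := mulr_gt0 tp ma; lra.
by rewrite mulrC ler_pM2l.
Qed.

Theorem theorem5 (R : realType) :
  (* (i) *)
  (forall (n t : nat) (p : 'rV[R]_n), (0 < n)%N -> (1 <= t)%N ->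
     ordered_prob_vector p -> local_maximum t p ->
     all_but_last_equal p /\ last_dominates p) /\
  (exists tau : nat -> R,
     (forall n : nat, (0 < n)%N -> n%:R < tau n) /\
     (* (ii) (a) *)
     (forall n t : nat, (0 < n)%N -> (1 <= t)%N -> t%:R < tau n ->
        unique_global_maximum t (const_mx n%:R^-1 : 'rV[R]_n)) /\
     (* (ii) (b) *)
     (forall n t : nat, (0 < n)%N -> (1 <= t)%N -> tau n < t%:R ->
        exists p : 'rV[R]_n,
          [/\ unique_global_maximum t p, all_but_last_equal p &
              last_strictly_dominates p]) /\
     (* (iii) *)
     (exists eps : nat -> R,
        eps n @[n --> \oo] --> (0 : R) /\
        (forall n : nat, (0 < n)%N ->
           tau n = n%:R + Num.sqrt (2%:R * n%:R) * (1 + eps n)))) /\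
  (* (iv) *)
  (forall (n t : nat) (p : 'rV[R]_n), (2 <= n)%N ->
     n%:R + Num.sqrt (2%:R * n%:R) <= t%:R :> R ->
     ordered_prob_vector p -> global_maximum t p ->
     forall i : 'I_n, i = 0%N :> nat ->
       (t%:R + 1)^-1 < p ord0 i /\
       p ord0 i < (t%:R + 1)^-1 + expR (- Num.sqrt (n%:R / 2%:R))).
Proof.
split.
  move=> n t p n0 t0 pord pmax; split; first exact: local_maximum_shape pmax.
  by move=> i k im km; apply: pord.2; rewrite km ltnW.
split; last first.
  move=> [//|[//|m']] t p _; set m := m'.+1 => nt pord pmax i i0.
  have m0 : (0 < m)%N by [].
  have [v [vv lt]] := uniform_beaten_large m0 nt.
  have pu : p <> const_mx m.+1%:R^-1.
    by move=> pu; have := pmax.2 v vv; rewrite pu leNgt lt.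
  have t1 : (1 < t)%N.
    rewrite -(ltr_nat R); apply: lt_le_trans nt.
    by rewrite ltr_pwDr ?sqrtr_gt0 ?mulr_gt0 ?ltr0n // ler_nat.
  have [_ pl] := nonuniform_maximum m0 t1 pord pmax pu.
  have -> : i = ord0 by exact: val_inj.
  exact: nonuniform_level_bounds pl.
have [tau tauP] := choice (@threshold_exists R).
exists tau; split; first by move=> n /tauP[].
split; first by move=> n t /tauP[_ + _ _]; apply.
split; first by move=> n t /tauP[_ _ + _]; apply.
pose s (n : nat) : R := Num.sqrt (2 * n%:R).
(* The error term is solved from the required identity; it is at most [5 / s n] in absolute value
   once [s n > 384]. *)
exists (fun n => (tau n - n%:R) / s n - 1); split; last first.
  move=> n n0; have sn : s n != 0.
    by rewrite gt_eqF // sqrtr_gt0 mulr_gt0 // ltr0n.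
  by rewrite -/(s n); field.
have s_large (A : R) : \forall n \near \oo, A < s n.
  exists (Num.truncn (A ^+ 2)).+1 => // n /= An.
  have := truncn_itv (sqr_ge0 A) => /andP[_ A2].
  have : A ^+ 2 < n%:R by apply: lt_le_trans A2 _; rewrite ler_nat.
  have s0 : 0 <= s n by exact: sqrtr_ge0.
  have s2 : s n ^+ 2 = 2 * n%:R by rewrite sqr_sqrtr // mulr_ge0.
  have : 0 <= n%:R :> R by [].
  by nra.
apply/cvgrPdist_lt => e e0; near=> n.
have sn : 384 < s n by near: n; exact: s_large.
have se : 5 / e < s n by near: n; exact: s_large.
have n0 : (0 < n)%N.
  by rewrite lt0n; apply/eqP => nz; move: sn; rewrite /s nz mulr0 sqrtr0; lra.
have [_ _ _ /(_ sn) bound] := tauP n n0.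
have sp : 0 < s n by lra.
rewrite sub0r normrN.
have -> : (tau n - n%:R) / s n - 1 = (tau n - n%:R - s n) / s n.
  by field; rewrite gt_eqF.
rewrite normrM normfV (gtr0_norm sp) ltr_pdivrMr //.
by apply: le_lt_trans bound _; move: se; rewrite ltr_pdivrMr // mulrC.
Unshelve. all: end_near.
Qed.
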